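(* Let $\Lambda<0$ and $\ell^2=-3/\Lambda$. There exists a neighbourhood $U\subset\mathbb{R}^3$ of the trivial initial data point $(S_1,\omega_2,\alpha_1)=(1,0,0)$ such that for all $(S_1,\omega_2,\alpha_1)\in U$, the corresponding unique static soliton solution $(\mu_0,S_0,\alpha_0,\omega_0)$ on $[0,\infty)$ of the static $\mathfrak{su}(2)$ Einstein-Yang-Mills equations (displayed in the context) satisfies $$\mathcal{K}_1(r)>0\quad\text{and}\quad \mathcal{K}_2(r)>0\qquad\text{for all } r>0,$$ where $\mathcal{K}_1,\mathcal{K}_2$ are the functions defined in the context from the solution, and thus this solution is linearly stable under spherically symmetric perturbations (in the sense defined in the context).
   Context: Static equations. The unknowns are real functions $m_0,S_0,\alpha_0,\omega_0$ of $r$, with $\mu_0(r)=1-\frac{2m_0(r)}{r}+\frac{r^2}{\ell^2}$ and $'=d/dr$. The static, spherically symmetric $\mathfrak{su}(2)$ Einstein-Yang-Mills equations with cosmological constant $\Lambda=-3/\ell^2$, for the metric $ds^2=-\mu_0S_0^2dt^2+\mu_0^{-1}dr^2+r^2(d\theta^2+\sin^2\theta\,d\phi^2)$, with electric gauge field function $\alpha_0$ and magnetic gauge field function $\omega_0$, are $$m_0'=\frac{r^2\alpha_0'^2}{2S_0^2}+\frac{\alpha_0^2\omega_0^2}{\mu_0S_0^2}+\mu_0\omega_0'^2+\frac{(1-\omega_0^2)^2}{2r^2},\qquad \frac{S_0'}{S_0}=\frac{2\omega_0'^2}{r}+\frac{2\alpha_0^2\omega_0^2}{r\mu_0^2S_0^2},$$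 $$0=\mu_0\alpha_0''+\Big(\frac{2\mu_0}{r}-\frac{\mu_0S_0'}{S_0}\Big)\alpha_0'-\frac{2\alpha_0\omega_0^2}{r^2},$$ $$0=\mu_0\omega_0''+\Big(\mu_0'+\frac{\mu_0S_0'}{S_0}\Big)\omega_0'+\frac{\omega_0(1-\omega_0^2)}{r^2}+\frac{\alpha_0^2\omega_0}{\mu_0S_0^2}.$$ They are invariant under $(S_0,\alpha_0)\to(\lambda S_0,\lambda\alpha_0)$ for any constant $\lambda\neq0$. Soliton initial data. Data $(S_1,\omega_2,\alpha_1)$ are imposed at the regular origin $r=0$ through the expansions, as $r\to0$, $$m_0=\Big(\frac{\alpha_1^2}{2S_1^2}+2\omega_2^2\Big)r^3+O(r^4),\qquad S_0=S_1+\Big(\frac{\alpha_1^2}{S_1}+4S_1\omega_2^2\Big)r^2+O(r^3),$$ $$\alpha_0=\alpha_1r+\frac{\alpha_1}{5}\Big(\frac{2\alpha_1^2}{S_1^2}+8\omega_2^2+2\omega_2-\frac1{\ell^2}\Big)r^3+O(r^4),\qquad \omega_0=1+\omega_2r^2+O(r^3).$$ Known existence result (from earlier work, may be assumed). For all data in a neighbourhood of the trivial point $(1,0,0)$ there is a unique global solution $(\mu_0,S_0,\alpha_0,\omega_0)\in C^1([0,\infty),\mathbb{R}^2)\times C^2([0,\infty),\mathbb{R}^2)$ with these data; it depends continuously on the data; it satisfies $\mu_0>0$, $\omega_0>0$, $S_0>0$ for all $r\ge0$; and it is asymptotically anti-de Sitter: after a scaling $(S_0,\alpha_0)\to(\lambda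 S_0,\lambda\alpha_0)$ making $S_0\to1$ as $r\to\infty$, one has $m_0=M+O(r^{-1})$, $S_0=1+O(r^{-4})$, $\alpha_0=\alpha_\infty+d_1/r+O(r^{-2})$, $\omega_0=\omega_\infty+c_1/r+O(r^{-2})$ as $r\to\infty$, for constants $M,\alpha_\infty,d_1,\omega_\infty,c_1$. The data $(1,0,0)$ give the trivial (pure anti-de Sitter) solution $\alpha_0\equiv0$, $\omega_0\equiv1$, $S_0\equiv1$, $m_0\equiv0$. This is the ''corresponding unique static soliton solution'' in the claim. The functions $\mathcal{E}_i$, $\mathcal{Z}_{12},\mathcal{Z}_{21}$, $\mathcal{K}_i$. For the unique global static soliton solution $(\mu_0,S_0,\alpha_0,\omega_0)$ on $[0,\infty)$ with data $(S_1,\omega_2,\alpha_1)$ at the origin in a neighbourhood of $(1,0,0)$ (so that $\mu_0>0$, $\omega_0>0$, $S_0>0$ for all $r\ge0$) define $$\mathcal{E}_1=\alpha_0^2+\frac{\mu_0S_0^2(1+\omega_0^2)}{r^2}+\frac{2\mu_0^2S_0^2\omega_0'^2}{\omega_0^2}+\frac{8\alpha_0\alpha_0'\omega_0^2}{r}-\frac{4\alpha_0^2\omega_0^2}{r}\Big(\frac1r+\frac{\mu_0'}{\mu_0}+\frac{S_0'}{S_0}\Big),$$ $$\mathcal{E}_2=2\mu_0S_0\alpha_0'-\frac{4S_0\alpha_0\omega_0^2(1-\omega_0^2)}{r^3}+\frac{4\mu_0S_0\omega_0\omega_0'\alpha_0'}{r}-\frac{4\mu_0S_0\alpha_0\omega_0\omega_0'}{r}\Big(\frac1r+\frac{r}{2\omega_0^2}+\frac{\mu_0'}{\mu_0}+\frac{S_0'}{S_0}\Big),$$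 $$\mathcal{E}_3=\mathcal{E}_2-2\mu_0S_0\alpha_0',$$ $$\mathcal{E}_4=3\alpha_0^2-\frac{\mu_0S_0^2(1-3\omega_0^2)}{r^2}-\frac{4\mu_0^2S_0^2\omega_0'^2}{r}\Big(\frac{\mu_0'}{\mu_0}+\frac{S_0'}{S_0}\Big)-\frac{4\mu_0S_0^2\omega_0'}{r^3}\big[2\omega_0(1-\omega_0^2)+r\mu_0\omega_0'\big],$$ $$\mathcal{Z}_{12}(r)=\int_{0}^r\frac{\mathcal{E}_2(s)}{\mu_0(s)S_0(s)}ds,\qquad \mathcal{Z}_{21}(r)=\int_{0}^r\frac{\mathcal{E}_3(s)}{\mu_0(s)S_0(s)}ds,$$ $$\mathcal{K}_1=\mathcal{E}_1-\mathcal{Z}_{21}^2,\qquad \mathcal{K}_2=\mathcal{E}_4-\mathcal{Z}_{12}^2 .$$ Linear stability. Let $r_*$ be the tortoise coordinate, $dr_*/dr=1/(\mu_0S_0)$, normalized so that $r_*=0$ at $r=0$; then $r_*$ ranges over $(0,r_{*\mathrm{max}})$ for $r\in(0,\infty)$, with $r_{*\mathrm{max}}<\infty$. Linear spherically symmetric perturbations of the solution reduce to the system $-\ddot{v}=\mathcal{U}v$ for $v=(\delta\kappa,\delta\omega)^T$ (the remaining perturbations being determined by $v$ up to coordinate gauge freedom), where $$\mathcal{U}=-\partial_{r_*}^2+\begin{pmatrix}0&2\alpha_0\\-2\alpha_0&0\end{pmatrix}\partial_{r_*}+\begin{pmatrix}\mathcal{E}_1&\mathcal{E}_2\\ \mathcal{E}_3&\mathcal{E}_4\end{pmatrix}.$$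 The solution is called linearly stable under spherically symmetric perturbations if $\mathcal{U}$ is a symmetric, positive operator with respect to the $L^2$ inner product $\langle u,v\rangle=\int u\cdot v\,dr_*$ over the range of $r_*$, acting on perturbations vanishing at both ends; explicitly, $\langle u,\mathcal{U}v\rangle=\langle\mathcal{U}u,v\rangle$ and $\langle v,\mathcal{U}v\rangle>0$ for $v\ne0$, for all $C^2$ functions $u,v$ of $r_*$ with values in $\mathbb{R}^2$ that tend to $0$ at both ends of the range of $r_*$ and for which the function, its $r_*$-derivative and its image under $\mathcal{U}$ are square integrable. *)

(* Defs.v *)
(* World: Stdlib reals with Coquelicot. *)
From Stdlib Require Export Reals ClassicalEpsilon.
From Coquelicot Require Export Coquelicot.
Open Scope R_scope.

(* All fields are total functions on R, but only their values on [0, oo) carry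
   meaning: every condition below looks at r >= 0 only. *)
Record profile := Profile {
  mu0 : R -> R;
  S0 : R -> R;
  alpha0 : R -> R;
  omega0 : R -> R }.

(* f = O(r^n) as r -> 0+ *)
Definition bigO_zero (n : nat) (f : R -> R) : Prop :=
  exists C d, 0 < d /\ forall r, 0 < r < d -> Rabs (f r) <= C * r ^ n.

(* f = O(r^-n) as r -> +oo *)
Definition bigO_infty (n : nat) (f : R -> R) : Prop :=
  exists C r0, 0 < r0 /\ forall r, r0 < r -> Rabs (f r) <= C / r ^ n.

(* f is C^k on [0, oo).  Coquelicot's derivatives are two-sided, so the end
   point is handled by asking that the derivatives on (0, oo) extend
   continuously to 0; by the mean value theorem this is the same as having
   continuous one-sided derivatives at 0. *)
Definition Ck_halfline (k : nat) (f : R -> R) : Prop :=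
  filterlim f (at_right 0) (locally (f 0)) /\
  forall j, (j <= k)%nat ->
    (forall r, 0 < r -> ex_derive_n f j r /\ continuous (Derive_n f j) r) /\
    exists l : R, filterlim (Derive_n f j) (at_right 0) (locally l).

(* f and g differ by less than eps on (0, b], with their derivatives up to
   order k; these sets generate the usual (locally uniform) topology of
   C^k([0, oo)). *)
Definition Ck_close (k : nat) (b eps : R) (f g : R -> R) : Prop :=
  forall j r, (j <= k)%nat -> 0 < r <= b ->
    Rabs (Derive_n f j r - Derive_n g j r) < eps.

Section FieldEquations.

Variable ell : R.
Variable s : profile.

Local Notation mu := (mu0 s).
Local Notation S := (S0 s).
Local Notation al := (alpha0 s).
Local Notation om := (omega0 s).

(* The relation mu0 = 1 - 2 m0 / r + r^2 / ell^2 solved for m0. *)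
Definition m0 (r : R) : R := r / 2 * (1 - mu r + r ^ 2 / ell ^ 2).

Definition mass_equation (r : R) : Prop :=
  Derive m0 r =
    r ^ 2 * Derive al r ^ 2 / (2 * S r ^ 2)
    + al r ^ 2 * om r ^ 2 / (mu r * S r ^ 2)
    + mu r * Derive om r ^ 2
    + (1 - om r ^ 2) ^ 2 / (2 * r ^ 2).

Definition S_equation (r : R) : Prop :=
  Derive S r / S r =
    2 * Derive om r ^ 2 / r
    + 2 * al r ^ 2 * om r ^ 2 / (r * mu r ^ 2 * S r ^ 2).

Definition alpha_equation (r : R) : Prop :=
  0 = mu r * Derive_n al 2 r
      + (2 * mu r / r - mu r * Derive S r / S r) * Derive al r
      - 2 * al r * om r ^ 2 / r ^ 2.

Definition omega_equation (r : R) : Prop :=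
  0 = mu r * Derive_n om 2 r
      + (Derive mu r + mu r * Derive S r / S r) * Derive om r
      + om r * (1 - om r ^ 2) / r ^ 2
      + al r ^ 2 * om r / (mu r * S r ^ 2).

(* Division is total in R, so the non-vanishing of mu0 and S0, without which
   the equations are meaningless, is required explicitly. *)
Definition static_EYM_solution : Prop :=
  Ck_halfline 1 mu /\ Ck_halfline 1 S /\
  Ck_halfline 2 al /\ Ck_halfline 2 om /\
  forall r, 0 < r ->
    mu r <> 0 /\ S r <> 0 /\
    mass_equation r /\ S_equation r /\ alpha_equation r /\ omega_equation r.

Definition soliton_data (S1 w2 a1 : R) : Prop :=
  bigO_zero 4 (fun r => m0 r - (a1 ^ 2 / (2 * S1 ^ 2) + 2 * w2 ^ 2) * r ^ 3) /\
  bigO_zero 3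
    (fun r => S r - (S1 + (a1 ^ 2 / S1 + 4 * S1 * w2 ^ 2) * r ^ 2)) /\
  bigO_zero 4
    (fun r => al r -
       (a1 * r
        + a1 / 5 * (2 * a1 ^ 2 / S1 ^ 2 + 8 * w2 ^ 2 + 2 * w2 - 1 / ell ^ 2)
          * r ^ 3)) /\
  bigO_zero 3 (fun r => om r - (1 + w2 * r ^ 2)).

Definition soliton_solution (S1 w2 a1 : R) : Prop :=
  static_EYM_solution /\ soliton_data S1 w2 a1.

Definition positive_profile : Prop :=
  forall r, 0 <= r -> 0 < mu r /\ 0 < om r /\ 0 < S r.

(* lam is the scaling (S0, alpha0) -> (lam S0, lam alpha0). *)
Definition asymptotically_AdS : Prop :=
  exists lam M ainf d1 winf c1 : R,
    lam <> 0 /\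
    bigO_infty 1 (fun r => m0 r - M) /\
    bigO_infty 4 (fun r => lam * S r - 1) /\
    bigO_infty 2 (fun r => lam * al r - (ainf + d1 / r)) /\
    bigO_infty 2 (fun r => om r - (winf + c1 / r)).

End FieldEquations.

Definition same_on_halfline (s s' : profile) : Prop :=
  forall r, 0 <= r ->
    mu0 s r = mu0 s' r /\ S0 s r = S0 s' r /\
    alpha0 s r = alpha0 s' r /\ omega0 s r = omega0 s' r.

Definition the_soliton (ell S1 w2 a1 : R) (s : profile) : Prop :=
  soliton_solution ell s S1 w2 a1 /\
  (forall s', soliton_solution ell s' S1 w2 a1 -> same_on_halfline s' s) /\
  positive_profile s /\
  asymptotically_AdS ell s.

(* Global existence, uniqueness and continuous dependence near the trivial data
   (S1, omega2, alpha1) = (1, 0, 0).  Dependence is continuous from the data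
   into C^1([0, oo), R^2) x C^2([0, oo), R^2) with its locally uniform
   topology: no uniformity as r -> oo is assumed. *)
Definition soliton_existence (ell : R) : Prop :=
  exists (V : R * R * R -> Prop) (sol : R -> R -> R -> profile),
    locally (1, 0, 0) V /\
    (forall S1 w2 a1, V (S1, w2, a1) ->
       the_soliton ell S1 w2 a1 (sol S1 w2 a1)) /\
    (forall S1 w2 a1, V (S1, w2, a1) ->
       forall b eps, 0 < b -> 0 < eps ->
       exists delta, 0 < delta /\
       forall S1' w2' a1', V (S1', w2', a1') ->
         Rabs (S1' - S1) < delta ->
         Rabs (w2' - w2) < delta ->
         Rabs (a1' - a1) < delta ->
         let s := sol S1 w2 a1 in
         let s' := sol S1' w2' a1' in
         Ck_close 1 b eps (mu0 s') (mu0 s) /\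
         Ck_close 1 b eps (S0 s') (S0 s) /\
         Ck_close 2 b eps (alpha0 s') (alpha0 s) /\
         Ck_close 2 b eps (omega0 s') (omega0 s)).

Section Stability.

Variable s : profile.

Local Notation mu := (mu0 s).
Local Notation S := (S0 s).
Local Notation al := (alpha0 s).
Local Notation om := (omega0 s).
Local Notation mu' := (Derive (mu0 s)).
Local Notation S' := (Derive (S0 s)).
Local Notation al' := (Derive (alpha0 s)).
Local Notation om' := (Derive (omega0 s)).

Definition E1 (r : R) : R :=
  al r ^ 2
  + mu r * S r ^ 2 * (1 + om r ^ 2) / r ^ 2
  + 2 * mu r ^ 2 * S r ^ 2 * om' r ^ 2 / om r ^ 2
  + 8 * al r * al' r * om r ^ 2 / r
  - 4 * al r ^ 2 * om r ^ 2 / r * (1 / r + mu' r / mu r + S' r / S r).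

Definition E2 (r : R) : R :=
  2 * mu r * S r * al' r
  - 4 * S r * al r * om r ^ 2 * (1 - om r ^ 2) / r ^ 3
  + 4 * mu r * S r * om r * om' r * al' r / r
  - 4 * mu r * S r * al r * om r * om' r / r
    * (1 / r + r / (2 * om r ^ 2) + mu' r / mu r + S' r / S r).

Definition E3 (r : R) : R := E2 r - 2 * mu r * S r * al' r.

Definition E4 (r : R) : R :=
  3 * al r ^ 2
  - mu r * S r ^ 2 * (1 - 3 * om r ^ 2) / r ^ 2
  - 4 * mu r ^ 2 * S r ^ 2 * om' r ^ 2 / r * (mu' r / mu r + S' r / S r)
  - 4 * mu r * S r ^ 2 * om' r / r ^ 3
    * (2 * om r * (1 - om r ^ 2) + r * mu r * om' r).

(* The integrands are continuous on (0, r] and bounded; their values at the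
   end point 0 do not affect the integrals. *)
Definition Z12 (r : R) : R := RInt (fun x => E2 x / (mu x * S x)) 0 r.
Definition Z21 (r : R) : R := RInt (fun x => E3 x / (mu x * S x)) 0 r.

Definition K1 (r : R) : R := E1 r - Z21 r ^ 2.
Definition K2 (r : R) : R := E4 r - Z12 r ^ 2.

Definition rstar (r : R) : R := RInt (fun x => / (mu x * S x)) 0 r.

(* The inverse of the increasing function rstar on (0, oo): the areal radius
   as a function of the tortoise coordinate. *)
Definition radius (x : R) : R :=
  epsilon (inhabits 0) (fun r => 0 < r /\ rstar r = x).

Definition dstar (v : R -> R * R) (x : R) : R * R :=
  (Derive (fun y => fst (v y)) x, Derive (fun y => snd (v y)) x).

(* The argument x is the tortoise coordinate. *)
Definition U_op (v : R -> R * R) (x : R) : R * R :=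
  let r := radius x in
  let dv := dstar v x in
  let ddv := dstar (dstar v) x in
  (- fst ddv + 2 * al r * snd dv + (E1 r * fst (v x) + E2 r * snd (v x)),
   - snd ddv - 2 * al r * fst dv + (E3 r * fst (v x) + E4 r * snd (v x))).

(* L^2 inner product over the open interval (0, X).  It is only applied to
   square integrable functions that are continuous on (0, X), for which the
   two-sided improper Riemann integral converges absolutely and agrees with the
   Lebesgue integral. *)
Definition inner (X : R) (u v : R -> R * R) : R :=
  RInt_gen (fun x => fst (u x) * fst (v x) + snd (u x) * snd (v x))
    (at_right 0) (at_left X).

Definition square_integrable (X : R) (u : R -> R * R) : Prop :=
  ex_RInt_gen (fun x => fst (u x) ^ 2 + snd (u x) ^ 2)
    (at_right 0) (at_left X).

Definition C2_on (X : R) (f : R -> R) : Prop :=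
  forall j x, (j <= 2)%nat -> 0 < x < X ->
    ex_derive_n f j x /\ continuous (Derive_n f j) x.

Definition admissible (X : R) (v : R -> R * R) : Prop :=
  C2_on X (fun x => fst (v x)) /\ C2_on X (fun x => snd (v x)) /\
  filterlim v (at_right 0) (locally (0, 0)) /\
  filterlim v (at_left X) (locally (0, 0)) /\
  square_integrable X v /\
  square_integrable X (dstar v) /\
  square_integrable X (U_op v).

(* X is the upper end r_*max of the range of the tortoise coordinate. *)
Definition linearly_stable : Prop :=
  exists X : R,
    is_lim rstar p_infty X /\
    (forall u v, admissible X u -> admissible X v ->
       inner X u (U_op v) = inner X (U_op u) v) /\
    (forall v, admissible X v ->
       (exists x, 0 < x < X /\ v x <> (0, 0)) ->
       0 < inner X v (U_op v)).

End Stability.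

(* Main.v *)
Require Import Defs.
From Stdlib Require Import Lra Lia Psatz Ranalysis5 FunctionalExtensionality.

(** Stability.  In the tortoise coordinate x one has dZ12/dx = E2, dZ21/dx = E3
    and Z12 - Z21 = 2 alpha0, so that, up to an exact derivative, u.Uv is the
    symmetric form
      (u1' - Z12 u2)(v1' - Z12 v2) + (u2' - Z21 u1)(v2' - Z21 v1)
        + K1 u1 v1 + K2 u2 v2.
    The boundary terms vanish along suitable sequences because the perturbations
    tend to 0 and their derivatives are square integrable.

    Positivity.  Near the trivial solution E1 and E4 are bounded below by a
    positive constant and Z12, Z21 are small, provided alpha0, omega0 - 1 and
    their derivatives are small with the right decay at both ends.  On (0, 1]
    this follows from C^1 x C^2 closeness and the data at the origin.  Continuous
    dependence says nothing uniform as r -> oo; there the sum Y of the squares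
    of alpha0, omega0 - 1, r^2 alpha0'/S0, mu0 S0 omega0', S0 - 1 and m0
    satisfies Y' <= C Y / r^2 as long as Y <= 1/16, hence Y(r) <= e^C Y(1). *)

(** * Calculus on the half-line *)

Lemma at_right_eps (f : R -> R) (a l : R) :
  filterlim f (at_right a) (locally l) <->
  forall eps, 0 < eps ->
    exists d, 0 < d /\ forall x, a < x < a + d -> Rabs (f x - l) < eps.
Proof.
  rewrite filterlim_locally; split.
  - intros H eps heps.
    destruct (H (mkposreal eps heps)) as [d Hd].
    exists d; split; [apply cond_pos|].
    intros x Hx. apply (Hd x); [|lra].
    change (Rabs (x - a) < d). rewrite Rabs_pos_eq; lra.
  - intros H eps. destruct (H eps (cond_pos eps)) as [d [hd Hd]].
    exists (mkposreal d hd). intros x Hx hx.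
    apply Hd. change (Rabs (x - a) < d) in Hx.
    apply Rabs_def2 in Hx. lra.
Qed.

Lemma at_left_eps (f : R -> R) (b l : R) :
  filterlim f (at_left b) (locally l) <->
  forall eps, 0 < eps ->
    exists d, 0 < d /\ forall x, b - d < x < b -> Rabs (f x - l) < eps.
Proof.
  rewrite filterlim_locally; split.
  - intros H eps heps.
    destruct (H (mkposreal eps heps)) as [d Hd].
    exists d; split; [apply cond_pos|].
    intros x Hx. apply (Hd x); [|lra].
    change (Rabs (x - b) < d). apply Rabs_def1; lra.
  - intros H eps. destruct (H eps (cond_pos eps)) as [d [hd Hd]].
    exists (mkposreal d hd). intros x Hx hx.
    apply Hd. change (Rabs (x - b) < d) in Hx.
    apply Rabs_def2 in Hx. lra.
Qed.

Lemma Derive_val (f : R -> R) (x l : R) :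
  is_derive f x l -> Derive (fun t : R => f t) x = l.
Proof. apply is_derive_unique. Qed.

Lemma is_derive_continuity_pt (f : R -> R) (x l : R) :
  is_derive f x l -> continuity_pt f x.
Proof.
  intros H. apply continuity_pt_filterlim.
  apply (ex_derive_continuous (V := R_NormedModule)). now exists l.
Qed.

Lemma MVT_on (f df : R -> R) (a b : R) :
  a <= b -> (forall x, a <= x <= b -> is_derive f x (df x)) ->
  exists c, a <= c <= b /\ f b - f a = df c * (b - a).
Proof.
  intros hab H.
  destruct (MVT_gen f a b df) as [c Hc];
    rewrite ?Rmin_left, ?Rmax_right in * by lra.
  - intros x Hx. apply H; lra.
  - intros x Hx. apply (is_derive_continuity_pt _ _ (df x)), H; lra.
  - exists c; exact Hc.
Qed.

Lemma derive_nonneg_le (f df : R -> R) (a b : R) :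
  a <= b -> (forall x, a <= x <= b -> is_derive f x (df x)) ->
  (forall x, a <= x <= b -> 0 <= df x) -> f a <= f b.
Proof.
  intros hab H Hp. destruct (MVT_on f df a b hab H) as [c [Hc E]].
  specialize (Hp c Hc). nra.
Qed.

Lemma derive_pos_lt (f df : R -> R) (a b : R) :
  a < b -> (forall x, a <= x <= b -> is_derive f x (df x)) ->
  (forall x, a <= x <= b -> 0 < df x) -> f a < f b.
Proof.
  intros hab H Hp. destruct (MVT_on f df a b (Rlt_le _ _ hab) H) as [c [Hc E]].
  specialize (Hp c Hc). nra.
Qed.

Lemma derive_bound_at_0 (f df : R -> R) (b M : R) (n : nat) :
  filterlim f (at_right 0) (locally 0) ->
  (forall x, 0 < x <= b -> is_derive f x (df x)) ->
  (forall x, 0 < x <= b -> Rabs (df x) <= M * x ^ n) ->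
  forall x, 0 < x <= b -> Rabs (f x) <= M * x ^ S n.
Proof.
  intros H0 Hd HM x Hx.
  assert (hM : 0 <= M).
  { pose proof (HM x Hx). pose proof (Rabs_pos (df x)).
    pose proof (pow_lt x n (proj1 Hx)). nra. }
  apply le_epsilon. intros eps heps.
  destruct (proj1 (at_right_eps f 0 0) H0 eps heps) as [d [hd Hdd]].
  set (y := Rmin (d / 2) (x / 2)).
  assert (hy : 0 < y < d /\ y < x).
  { unfold y. pose proof (Rmin_l (d/2) (x/2)). pose proof (Rmin_r (d/2) (x/2)).
    assert (0 < Rmin (d / 2) (x / 2)) by (apply Rmin_glb_lt; lra). lra. }
  assert (Hy : Rabs (f y - 0) < eps) by (apply Hdd; lra).
  destruct (MVT_on f df y x) as [c [Hc E]]; [lra|intros; apply Hd; lra|].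
  assert (Hb : Rabs (f x - f y) <= M * x ^ n * x).
  { rewrite E, Rabs_mult. apply Rmult_le_compat; try apply Rabs_pos.
    - apply Rle_trans with (M * c ^ n); [apply HM; lra|].
      apply Rmult_le_compat_l; [lra|]. apply pow_incr; lra.
    - rewrite Rabs_pos_eq; lra. }
  replace (f x) with ((f x - f y) + (f y - 0)) by ring.
  eapply Rle_trans; [apply Rabs_triang|]. simpl. nra.
Qed.

(* Coquelicot's integral needs a two-sided extension of the integrand to be
   continuous; the constant extension to the left of the end point serves. *)
Lemma ex_RInt_right_limit (f : R -> R) (a b l : R) :
  a <= b -> filterlim f (at_right a) (locally l) ->
  (forall x, a < x <= b -> continuous f x) -> ex_RInt f a b.
Proof.
  intros hab Hl Hc.
  set (g := fun x => if Rle_dec x a then l else f x).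
  apply ex_RInt_ext with g.
  - intros x. rewrite Rmin_left, Rmax_right by lra. intros Hx.
    unfold g. destruct (Rle_dec x a); [lra|reflexivity].
  - apply (ex_RInt_continuous (V := R_CompleteNormedModule)).
    intros x. rewrite Rmin_left, Rmax_right by lra. intros Hx.
    destruct (Rle_lt_or_eq_dec a x (proj1 Hx)) as [h|<-].
    + apply continuous_ext_loc with f; [|apply Hc; lra].
      exists (mkposreal (x - a) (proj2 (Rlt_0_minus _ _) h)). intros y Hy.
      change (Rabs (y - x) < x - a) in Hy. apply Rabs_def2 in Hy.
      unfold g. destruct (Rle_dec y a); [lra|reflexivity].
    + apply filterlim_locally. intros eps.
      destruct (proj1 (at_right_eps f a l) Hl eps (cond_pos eps)) as [d [hd Hd]].
      exists (mkposreal d hd). intros y Hy.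
      change (Rabs (y - a) < d) in Hy. apply Rabs_def2 in Hy.
      change (Rabs (g y - g a) < eps). unfold g.
      destruct (Rle_dec a a); [|lra].
      destruct (Rle_dec y a).
      * replace (l - l) with 0 by ring. rewrite Rabs_R0. apply cond_pos.
      * apply Hd; lra.
Qed.

Lemma is_derive_RInt_right_limit (f : R -> R) (a x l : R) :
  filterlim f (at_right a) (locally l) ->
  (forall y, a < y -> continuous f y) -> a < x ->
  is_derive (fun y => RInt f a y) x (f x).
Proof.
  intros Hl Hc hx.
  apply (is_derive_RInt f (fun y => RInt f a y) a x); [|now apply Hc].
  exists (mkposreal (x - a) (proj2 (Rlt_0_minus _ _) hx)). intros y Hy.
  change (Rabs (y - x) < x - a) in Hy. apply Rabs_def2 in Hy.
  apply (RInt_correct (V := R_CompleteNormedModule)).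
  apply ex_RInt_right_limit with l; [lra|assumption|].
  intros z Hz. apply Hc; lra.
Qed.

Lemma RInt_right_limit_at_0 (f : R -> R) (a l : R) :
  filterlim f (at_right a) (locally l) ->
  (forall y, a < y -> continuous f y) ->
  filterlim (fun y => RInt f a y) (at_right a) (locally 0).
Proof.
  intros Hl Hc. apply at_right_eps. intros eps heps.
  destruct (proj1 (at_right_eps f a l) Hl 1 Rlt_0_1) as [d [hd Hd]].
  set (M := Rabs l + Rabs (f a) + 1).
  assert (hM : 0 < M) by (unfold M; pose proof (Rabs_pos l); pose proof (Rabs_pos (f a)); lra).
  exists (Rmin d (eps / M)). split.
  { apply Rmin_glb_lt; [lra|]. now apply Rdiv_lt_0_compat. }
  intros x Hx. pose proof (Rmin_l d (eps / M)). pose proof (Rmin_r d (eps / M)).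
  rewrite Rminus_0_r.
  apply Rle_lt_trans with ((x - a) * M).
  - apply abs_RInt_le_const; [lra| |].
    + apply ex_RInt_right_limit with l; [lra|assumption|].
      intros z Hz; apply Hc; lra.
    + intros t Ht. destruct (Rle_lt_or_eq_dec a t (proj1 Ht)) as [h|<-].
      * assert (Ht' : Rabs (f t - l) < 1) by (apply Hd; lra).
        replace (f t) with (f t - l + l) by ring.
        eapply Rle_trans; [apply Rabs_triang|].
        unfold M. pose proof (Rabs_pos (f a)). lra.
      * unfold M. pose proof (Rabs_pos l). lra.
  - apply Rlt_le_trans with (eps / M * M); [apply Rmult_lt_compat_r; lra|].
    right; field; lra.
Qed.

Lemma constant_of_derive_0 (f : R -> R) :
  filterlim f (at_right 0) (locally 0) ->
  (forall x, 0 < x -> is_derive f x 0) -> forall x, 0 < x -> f x = 0.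
Proof.
  intros H0 Hd x hx.
  assert (H : Rabs (f x) <= 0 * x ^ 1).
  { apply (derive_bound_at_0 f (fun _ => 0) x 0 0); auto; try lra.
    - intros y Hy; apply Hd; lra.
    - intros; rewrite Rabs_R0; lra. }
  rewrite Rmult_0_l in H. pose proof (Rabs_pos (f x)).
  destruct (Req_dec (f x) 0) as [E|E]; [exact E|].
  pose proof (Rabs_pos_lt _ E). lra.
Qed.

Lemma quotient_limit_at_0 (f df : R -> R) (l : R) :
  filterlim f (at_right 0) (locally 0) ->
  (forall x, 0 < x -> is_derive f x (df x)) ->
  filterlim df (at_right 0) (locally l) ->
  filterlim (fun x => f x / x) (at_right 0) (locally l).
Proof.
  intros H0 Hd Hl. apply at_right_eps. intros eps heps.
  destruct (proj1 (at_right_eps df 0 l) Hl (eps / 2)) as [d [hd Hdd]]; [lra|].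
  exists d; split; [assumption|]. intros x Hx.
  assert (H : Rabs (f x - l * x) <= eps / 2 * x ^ 1).
  { apply (derive_bound_at_0 (fun y => f y - l * y) (fun y => df y - l) x (eps / 2) 0);
      [| | |lra].
    - apply at_right_eps. intros e he.
      destruct (proj1 (at_right_eps f 0 0) H0 (e / 2)) as [d1 [hd1 Hd1]]; [lra|].
      assert (hl : 0 < Rabs l + 1) by (pose proof (Rabs_pos l); lra).
      exists (Rmin d1 (e / 2 / (Rabs l + 1))). split.
      + apply Rmin_glb_lt; [lra|]. apply Rdiv_lt_0_compat; lra.
      + intros y Hy. pose proof (Rmin_l d1 (e / 2 / (Rabs l + 1))).
        pose proof (Rmin_r d1 (e / 2 / (Rabs l + 1))).
        assert (A : Rabs (f y - 0) < e / 2) by (apply Hd1; lra).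
        assert (B : Rabs (l * y) <= e / 2).
        { rewrite Rabs_mult, (Rabs_pos_eq y) by lra.
          apply Rle_trans with ((Rabs l + 1) * (e / 2 / (Rabs l + 1))).
          - apply Rmult_le_compat; try apply Rabs_pos; lra.
          - right; field; lra. }
        replace (f y - l * y - 0) with ((f y - 0) + - (l * y)) by ring.
        eapply Rle_lt_trans; [apply Rabs_triang|]. rewrite Rabs_Ropp. lra.
    - intros y Hy. auto_derive.
      + exists (df y). apply Hd; lra.
      + rewrite (Derive_val f y (df y)) by (apply Hd; lra). ring.
    - intros y Hy. simpl. rewrite Rmult_1_r. left. apply Hdd; lra. }
  replace (f x / x - l) with ((f x - l * x) / x) by (field; lra).
  unfold Rdiv. rewrite Rabs_mult, (Rabs_pos_eq (/ x)) by (left; apply Rinv_0_lt_compat; lra).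
  apply Rle_lt_trans with (eps / 2 * x ^ 1 * / x).
  - apply Rmult_le_compat_r; [left; apply Rinv_0_lt_compat; lra|exact H].
  - simpl. replace (eps / 2 * (x * 1) * / x) with (eps / 2) by (field; lra). lra.
Qed.

Lemma bootstrap (f : R -> R) (a M : R) :
  (forall x, a <= x -> continuity_pt f x) -> f a < M ->
  (forall b, a <= b -> (forall x, a <= x <= b -> f x <= M) -> f b < M) ->
  forall x, a <= x -> f x < M.
Proof.
  intros Hc Ha Hstep.
  set (E := fun b => a <= b /\ forall x, a <= x <= b -> f x < M).
  assert (HE : E a).
  { split; [lra|]. intros x Hx. replace x with a by lra. exact Ha. }
  intros x hx. destruct (Rlt_dec (f x) M) as [h|h]; [exact h|exfalso].
  destruct (completeness E) as [s [Hub Hlub]].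
  - exists x. intros b [hb Hb]. apply Rnot_lt_le. intros hlt.
    apply h, Hb; lra.
  - exists a; exact HE.
  - assert (has : a <= s) by now apply Hub.
    assert (Hs : forall y, a <= y < s -> f y < M).
    { intros y Hy. apply Rnot_le_lt. intros hy.
      assert (s <= y); [|lra]. apply Hlub. intros b [hb Hb].
      apply Rnot_lt_le. intros hlt. specialize (Hb y). lra. }
    assert (Hsc : f s <= M).
    { apply Rnot_lt_le. intros hlt.
      assert (hne : a < s).
      { destruct has as [|<-]; [assumption|lra]. }
      destruct (Hc s has (f s - M)) as [d [hd Hd]]; [lra|].
      pose (y := Rmax a (s - d / 2)).
      assert (hy : a <= y < s /\ s - d < y).
      { unfold y. split; [split; [apply Rmax_l|apply Rmax_lub_lt; lra]|].
        apply Rlt_le_trans with (s - d / 2); [lra|apply Rmax_r]. }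
      assert (Hy : Rabs (f y - f s) < f s - M).
      { apply (Hd y). split; [split; [exact I|lra]|].
        change (Rabs (y - s) < d). apply Rabs_def1; lra. }
      apply Rabs_def2 in Hy. pose proof (Hs y (proj1 hy)). lra. }
    assert (Hss : f s < M).
    { apply Hstep; [exact has|]. intros y Hy.
      destruct (Rle_lt_or_eq_dec y s (proj2 Hy)) as [h1|h1]; [|rewrite h1; exact Hsc].
      left; apply Hs; lra. }
    destruct (Hc s has (M - f s)) as [d [hd Hd]]; [lra|].
    assert (E (s + d / 2)).
    { split; [lra|]. intros y Hy.
      destruct (Rlt_dec y s) as [h1|h1]; [apply Hs; lra|].
      destruct (Req_dec s y) as [<-|hne]; [exact Hss|].
      assert (Hy' : Rabs (f y - f s) < M - f s).
      { apply (Hd y). split; [split; [exact I|lra]|].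
        change (Rabs (y - s) < d). apply Rabs_def1; lra. }
      apply Rabs_def2 in Hy'. lra. }
    specialize (Hub _ H). lra.
Qed.

Lemma is_derive_inverse (F f G : R -> R) (X : R) :
  (forall r, 0 < r -> is_derive F r (f r)) ->
  (forall r, 0 < r -> 0 < f r) ->
  (forall x, 0 < x < X -> 0 < G x /\ F (G x) = x) ->
  forall x, 0 < x < X -> is_derive G x (/ f (G x)).
Proof.
  intros HF Hf HG x Hx.
  assert (Finc : forall r s, 0 < r -> r < s -> F r < F s).
  { intros r s hr hrs. apply derive_pos_lt with f; [assumption| |];
      intros y Hy; [apply HF|apply Hf]; lra. }
  destruct (HG x Hx) as [hr Er]. set (r := G x) in *.
  assert (Gc : forall e, 0 < e -> exists d, 0 < d /\
    forall y, 0 < y < X -> Rabs (y - x) < d -> Rabs (G y - r) < e).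
  { intros e he. set (e' := Rmin e (r / 2)).
    assert (he' : 0 < e' /\ e' <= e /\ e' <= r / 2).
    { unfold e'. repeat split; [apply Rmin_glb_lt; lra|apply Rmin_l|apply Rmin_r]. }
    pose proof (Finc (r - e') r ltac:(lra) ltac:(lra)).
    pose proof (Finc r (r + e') ltac:(lra) ltac:(lra)).
    exists (Rmin (x - F (r - e')) (F (r + e') - x)). split.
    { apply Rmin_glb_lt; lra. }
    intros y Hy Hyx. pose proof (Rmin_l (x - F (r - e')) (F (r + e') - x)).
    pose proof (Rmin_r (x - F (r - e')) (F (r + e') - x)).
    apply Rabs_def2 in Hyx. destruct (HG y Hy) as [hs Es].
    assert (G y < r + e').
    { apply Rnot_le_lt. intros h. destruct (Req_dec (G y) (r + e')) as [e1|e1].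
      - rewrite e1 in Es. lra.
      - pose proof (Finc (r + e') (G y) ltac:(lra) ltac:(lra)). lra. }
    assert (r - e' < G y).
    { apply Rnot_le_lt. intros h. destruct (Req_dec (G y) (r - e')) as [e1|e1].
      - rewrite e1 in Es. lra.
      - pose proof (Finc (G y) (r - e') ltac:(lra) ltac:(lra)). lra. }
    apply Rabs_def1; lra. }
  apply is_derive_Reals. intros eps heps.
  pose proof (Hf r hr) as hfr.
  pose proof (proj1 (is_derive_Reals F r (f r)) (HF r hr)) as HFr.
  set (e1 := Rmin (f r / 2) (eps * f r * f r / 2)).
  assert (he1 : 0 < e1 /\ e1 <= f r / 2 /\ e1 <= eps * f r * f r / 2).
  { unfold e1. repeat split; [|apply Rmin_l|apply Rmin_r].
    apply Rmin_glb_lt; [lra|].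
    assert (0 < eps * f r) by now apply Rmult_lt_0_compat.
    assert (0 < eps * f r * f r) by now apply Rmult_lt_0_compat. lra. }
  destruct (HFr e1 (proj1 he1)) as [d1 Hd1].
  destruct (Gc d1 (cond_pos d1)) as [d2 [hd2 Hd2]].
  assert (hd : 0 < Rmin d2 (Rmin x (X - x))).
  { repeat apply Rmin_glb_lt; lra. }
  exists (mkposreal _ hd). intros h hh0 hh. simpl in hh.
  pose proof (Rmin_l d2 (Rmin x (X - x))). pose proof (Rmin_r d2 (Rmin x (X - x))).
  pose proof (Rmin_l x (X - x)). pose proof (Rmin_r x (X - x)).
  assert (Hxh : 0 < x + h < X) by (apply Rabs_def2 in hh; lra).
  destruct (HG (x + h) Hxh) as [hs Es].
  assert (Hk : Rabs (G (x + h) - r) < d1).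
  { apply Hd2; [assumption|]. replace (x + h - x) with h by ring. lra. }
  fold r. set (k := G (x + h) - r) in *.
  assert (hk : k <> 0).
  { intros e. assert (e' : G (x + h) = r) by (unfold k in e; lra).
    rewrite e', Er in Es. lra. }
  pose proof (Hd1 k hk Hk) as Hq.
  assert (eh : F (r + k) - F r = h).
  { unfold k. replace (r + (G (x + h) - r)) with (G (x + h)) by ring. lra. }
  rewrite eh in Hq. set (q := h / k) in *.
  assert (hq : f r / 2 < q) by (apply Rabs_def2 in Hq; lra).
  replace (k / h) with (/ q) by (unfold q; field; auto).
  replace (/ q - / f r) with ((f r - q) * / (q * f r)) by (field; lra).
  assert (hp : 0 < q * f r) by (apply Rmult_lt_0_compat; lra).
  rewrite Rabs_mult, (Rabs_pos_eq (/ _)) by (left; now apply Rinv_0_lt_compat).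
  apply Rmult_lt_reg_r with (q * f r); [assumption|].
  rewrite Rmult_assoc, Rinv_l, Rmult_1_r by lra.
  rewrite Rabs_minus_sym.
  apply Rlt_le_trans with e1; [exact Hq|].
  apply Rle_trans with (eps * f r * f r / 2); [lra|].
  assert (f r / 2 * f r <= q * f r) by (apply Rmult_le_compat_r; lra).
  nra.
Qed.

Lemma is_derive_cont (f : R -> R) (x l : R) : is_derive f x l -> continuous f x.
Proof.
  intros H. apply (ex_derive_continuous (V := R_NormedModule)). now exists l.
Qed.

Lemma is_derive_eq (f : R -> R) (x l l' : R) :
  is_derive f x l -> l = l' -> is_derive f x l'.
Proof. now intros H <-. Qed.

Lemma is_derive_Rplus (f g : R -> R) (x fl gl : R) :
  is_derive f x fl -> is_derive g x gl -> is_derive (fun t => f t + g t) x (fl + gl).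
Proof. exact (is_derive_plus f g x fl gl). Qed.

Lemma is_derive_Ropp (f : R -> R) (x fl : R) :
  is_derive f x fl -> is_derive (fun t => - f t) x (- fl).
Proof. exact (is_derive_opp f x fl). Qed.

Lemma is_derive_Rmult (f g : R -> R) (x fl gl : R) :
  is_derive f x fl -> is_derive g x gl ->
  is_derive (fun t => f t * g t) x (fl * g x + f x * gl).
Proof. intros Hf Hg. exact (is_derive_mult f g x fl gl Hf Hg Rmult_comm). Qed.

Lemma cont_Rplus (f g : R -> R) (x : R) :
  continuous f x -> continuous g x -> continuous (fun t => f t + g t) x.
Proof. exact (continuous_plus f g x). Qed.

Lemma cont_Rmult (f g : R -> R) (x : R) :
  continuous f x -> continuous g x -> continuous (fun t => f t * g t) x.
Proof. exact (continuous_mult f g x). Qed.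

Lemma cont_Ropp (f : R -> R) (x : R) :
  continuous f x -> continuous (fun t => - f t) x.
Proof. exact (continuous_opp f x). Qed.

Lemma cont_Rminus (f g : R -> R) (x : R) :
  continuous f x -> continuous g x -> continuous (fun t => f t - g t) x.
Proof. exact (continuous_minus f g x). Qed.

Lemma cont_Rpow (f : R -> R) (n : nat) (x : R) :
  continuous f x -> continuous (fun t => f t ^ n) x.
Proof.
  intros H. induction n as [|n IH]; simpl.
  - apply continuous_const.
  - now apply cont_Rmult.
Qed.

Lemma cont_Rdiv (f g : R -> R) (x : R) :
  continuous f x -> continuous g x -> g x <> 0 -> continuous (fun t => f t / g t) x.
Proof.
  intros Hf Hg h. apply (cont_Rmult f (fun t => / g t) x Hf).
  now apply (continuous_comp g Rinv x Hg), continuous_Rinv.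
Qed.

Ltac cont_step :=
  match goal with
  | |- continuous (fun t => @?f t + @?g t) ?x => apply (cont_Rplus f g x)
  | |- continuous (fun t => @?f t - @?g t) ?x => apply (cont_Rminus f g x)
  | |- continuous (fun t => - @?f t) ?x => apply (cont_Ropp f x)
  | |- continuous (fun t => @?f t * @?g t) ?x => apply (cont_Rmult f g x)
  | |- continuous (fun t => @?f t ^ ?n) ?x => apply (cont_Rpow f n x)
  | |- continuous (fun t => @?f t / @?g t) ?x => apply (cont_Rdiv f g x)
  | |- continuous (fun t => ?c) ?x => apply continuous_const
  end.

Ltac cont := repeat (cbv beta; cont_step); cbv beta; try assumption.

Lemma is_derive_sq (f : R -> R) (x l : R) :
  is_derive f x l -> is_derive (fun t => f t ^ 2) x (2 * f x * l).
Proof.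
  intros H. apply is_derive_eq with (l * f x + f x * l); [|ring].
  apply (is_derive_ext (fun t => f t * f t)); [intros t; exact (Rsqr_pow2 (f t))|].
  now apply is_derive_Rmult.
Qed.

Lemma is_derive_Rdiv (f g : R -> R) (x fl gl : R) :
  is_derive f x fl -> is_derive g x gl -> g x <> 0 ->
  is_derive (fun t => f t / g t) x ((fl * g x - f x * gl) / g x ^ 2).
Proof. intros Hf Hg h. now apply is_derive_div. Qed.

(** * Integrals over an open interval and boundary points *)

Lemma RInt_gen_eps (f : R -> R) (a b l : R) :
  is_RInt_gen f (at_right a) (at_left b) l ->
  forall eps, 0 < eps -> exists d, 0 < d /\
    forall x y, a < x < a + d -> b - d < y < b ->
      exists I, is_RInt f x y I /\ Rabs (I - l) < eps.
Proof.
  intros H eps heps.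
  destruct (H (fun z => Rabs (z - l) < eps)) as [P Q [d1 H1] [d2 H2] HPQ].
  { exists (mkposreal eps heps). now intros z Hz. }
  exists (Rmin d1 d2). split; [apply Rmin_glb_lt; apply cond_pos|].
  intros x y Hx Hy. pose proof (Rmin_l d1 d2). pose proof (Rmin_r d1 d2).
  destruct (HPQ x y) as [I HI]; [| |now exists I].
  - apply H1; [|lra]. change (Rabs (x - a) < d1). apply Rabs_def1; lra.
  - apply H2; [|lra]. change (Rabs (y - b) < d2). apply Rabs_def1; lra.
Qed.

Section OpenInterval.

Variable X : R.
Hypothesis hX : 0 < X.

Lemma ex_RInt_inside (f : R -> R) (x y : R) :
  (forall t, 0 < t < X -> continuous f t) -> 0 < x < X -> 0 < y < X ->
  ex_RInt f x y.
Proof.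
  intros Hc Hx Hy. apply (ex_RInt_continuous (V := R_CompleteNormedModule)).
  intros z Hz. apply Hc.
  pose proof (Rmin_glb_lt x y 0 ltac:(lra) ltac:(lra)).
  pose proof (Rmax_lub_lt x y X ltac:(lra) ltac:(lra)). lra.
Qed.

Lemma RInt_inside_primitive (f : R -> R) (x y : R) :
  (forall t, 0 < t < X -> continuous f t) -> 0 < x < X -> 0 < y < X ->
  RInt f x y = RInt f (X / 2) y - RInt f (X / 2) x.
Proof.
  intros Hc Hx Hy.
  pose proof (RInt_Chasles f (X / 2) x y
    (ex_RInt_inside f (X / 2) x Hc ltac:(lra) Hx) (ex_RInt_inside f x y Hc Hx Hy)) as E.
  change (RInt f (X / 2) x + RInt f x y = RInt f (X / 2) y) in E. lra.
Qed.

Lemma is_derive_inside_primitive (f : R -> R) (x : R) :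
  (forall t, 0 < t < X -> continuous f t) -> 0 < x < X ->
  is_derive (fun y => RInt f (X / 2) y) x (f x).
Proof.
  intros Hc Hx.
  apply (is_derive_RInt f (fun y => RInt f (X / 2) y) (X / 2) x); [|now apply Hc].
  assert (hd : 0 < Rmin x (X - x)) by (apply Rmin_glb_lt; lra).
  exists (mkposreal _ hd). intros y Hy. change (Rabs (y - x) < Rmin x (X - x)) in Hy.
  pose proof (Rmin_l x (X - x)). pose proof (Rmin_r x (X - x)).
  apply Rabs_def2 in Hy. apply (RInt_correct (V := R_CompleteNormedModule)).
  apply ex_RInt_inside; [exact Hc| |]; lra.
Qed.

Lemma primitive_cauchy (g : R -> R) :
  (forall t, 0 < t < X -> continuous g t) ->
  ex_RInt_gen g (at_right 0) (at_left X) ->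
  forall eps, 0 < eps -> exists d, 0 < d <= X / 2 /\
    (forall x x', 0 < x < d -> 0 < x' < d ->
       Rabs (RInt g (X / 2) x - RInt g (X / 2) x') < eps) /\
    (forall y y', X - d < y < X -> X - d < y' < X ->
       Rabs (RInt g (X / 2) y - RInt g (X / 2) y') < eps).
Proof.
  intros Hc [l Hl] eps heps.
  destruct (RInt_gen_eps g 0 X l Hl (eps / 2)) as [d0 [hd0 Hd0]]; [lra|].
  assert (H : forall x y, 0 < x < X -> 0 < y < X -> x < d0 -> X - d0 < y ->
    Rabs (RInt g (X / 2) y - RInt g (X / 2) x - l) < eps / 2).
  { intros x y Hx Hy hx hy. destruct (Hd0 x y) as [I [HI HIl]]; [lra|lra|].
    rewrite <- (is_RInt_unique _ _ _ _ HI), RInt_inside_primitive in HIl by assumption.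
    exact HIl. }
  pose (d := Rmin d0 (X / 2)).
  assert (hd : 0 < d /\ d <= d0 /\ d <= X / 2).
  { unfold d. repeat split; [apply Rmin_glb_lt; lra|apply Rmin_l|apply Rmin_r]. }
  exists d. split; [lra|]. split.
  - intros x x' Hx Hx'.
    pose proof (H x (X - d / 2) ltac:(lra) ltac:(lra) ltac:(lra) ltac:(lra)) as A1.
    pose proof (H x' (X - d / 2) ltac:(lra) ltac:(lra) ltac:(lra) ltac:(lra)) as A2.
    apply Rabs_def2 in A1. apply Rabs_def2 in A2. apply Rabs_def1; lra.
  - intros y y' Hy Hy'.
    pose proof (H (d / 2) y ltac:(lra) ltac:(lra) ltac:(lra) ltac:(lra)) as A1.
    pose proof (H (d / 2) y' ltac:(lra) ltac:(lra) ltac:(lra) ltac:(lra)) as A2.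
    apply Rabs_def2 in A1. apply Rabs_def2 in A2. apply Rabs_def1; lra.
Qed.

Lemma primitive_increment_dominated (f g : R -> R) (x y : R) :
  (forall t, 0 < t < X -> continuous f t) ->
  (forall t, 0 < t < X -> continuous g t) ->
  (forall t, 0 < t < X -> Rabs (f t) <= g t) ->
  0 < x < X -> 0 < y < X ->
  Rabs (RInt f (X / 2) y - RInt f (X / 2) x)
    <= Rabs (RInt g (X / 2) y - RInt g (X / 2) x).
Proof.
  intros Hf Hg Hfg.
  assert (H : forall x y, 0 < x < X -> 0 < y < X -> x <= y ->
    Rabs (RInt f (X / 2) y - RInt f (X / 2) x)
      <= Rabs (RInt g (X / 2) y - RInt g (X / 2) x)).
  { clear x y. intros x y Hx Hy hxy.
    assert (A1 : RInt g (X / 2) x - RInt f (X / 2) x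
                 <= RInt g (X / 2) y - RInt f (X / 2) y).
    { apply (derive_nonneg_le (fun t => RInt g (X / 2) t - RInt f (X / 2) t)
               (fun t => g t - f t)); [assumption| |].
      - intros t Ht.
        apply (is_derive_minus (fun t => RInt g (X / 2) t) (fun t => RInt f (X / 2) t));
          apply is_derive_inside_primitive; auto; lra.
      - intros t Ht. pose proof (Hfg t ltac:(lra)). pose proof (Rle_abs (f t)). lra. }
    assert (A2 : RInt g (X / 2) x + RInt f (X / 2) x
                 <= RInt g (X / 2) y + RInt f (X / 2) y).
    { apply (derive_nonneg_le (fun t => RInt g (X / 2) t + RInt f (X / 2) t)
               (fun t => g t + f t)); [assumption| |].
      - intros t Ht.
        apply (is_derive_plus (fun t => RInt g (X / 2) t) (fun t => RInt f (X / 2) t));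
          apply is_derive_inside_primitive; auto; lra.
      - intros t Ht. pose proof (Hfg t ltac:(lra)).
        pose proof (Rle_abs (- f t)). rewrite Rabs_Ropp in *. lra. }
    eapply Rle_trans; [|apply Rle_abs]. apply Rabs_le; lra. }
  intros Hx Hy. destruct (Rle_dec x y) as [h|h]; [now apply H|].
  rewrite (Rabs_minus_sym (RInt f _ y)), (Rabs_minus_sym (RInt g _ y)).
  apply H; lra.
Qed.

Lemma ex_RInt_gen_dominated (f g : R -> R) :
  (forall t, 0 < t < X -> continuous f t) ->
  (forall t, 0 < t < X -> continuous g t) ->
  (forall t, 0 < t < X -> Rabs (f t) <= g t) ->
  ex_RInt_gen g (at_right 0) (at_left X) ->
  ex_RInt_gen f (at_right 0) (at_left X).
Proof.
  intros Hf Hg Hfg Hex.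
  assert (Hin : forall d, 0 < d -> filter_prod (at_right 0) (at_left X)
    (fun ab => 0 < fst ab < d /\ X - d < snd ab < X)).
  { intros d hd. exists (fun x => 0 < x < d) (fun y => X - d < y < X).
    - exists (mkposreal d hd). intros x Hx hx.
      change (Rabs (x - 0) < d) in Hx. apply Rabs_def2 in Hx. lra.
    - exists (mkposreal d hd). intros x Hx hx.
      change (Rabs (x - X) < d) in Hx. apply Rabs_def2 in Hx. lra.
    - intros x y Hx Hy. now split. }
  destruct (proj1 (filterlim_locally_cauchy (U := R_CompleteSpace)
    (F := filter_prod (at_right 0) (at_left X))
    (fun ab : R * R => RInt f (fst ab) (snd ab)))) as [l Hl].
  - intros eps.
    destruct (primitive_cauchy g Hg Hex (eps / 2)) as [d [hd [H1 H2]]].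
    { pose proof (cond_pos eps). lra. }
    exists (fun ab => 0 < fst ab < d /\ X - d < snd ab < X). split; [apply Hin; lra|].
    intros [x y] [x' y'] [Hx Hy] [Hx' Hy']. simpl in *.
    change (Rabs (RInt f x' y' - RInt f x y) < eps).
    rewrite (RInt_inside_primitive f x' y'), (RInt_inside_primitive f x y)
      by (auto; lra).
    replace (_ - _) with
      ((RInt f (X / 2) y' - RInt f (X / 2) y) + (RInt f (X / 2) x - RInt f (X / 2) x'))
      by ring.
    eapply Rle_lt_trans; [apply Rabs_triang|].
    pose proof (primitive_increment_dominated f g y y' Hf Hg Hfg ltac:(lra) ltac:(lra)).
    pose proof (primitive_increment_dominated f g x' x Hf Hg Hfg ltac:(lra) ltac:(lra)).
    pose proof (H1 x x' Hx Hx'). pose proof (H2 y' y Hy' Hy). lra.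
  - exists l. intros P HP.
    pose proof (Hl P HP) as HlP. unfold filtermap in HlP.
    refine (filter_imp _ _ _ (filter_and _ _ HlP (Hin X hX))).
    intros [x y] [HPxy [Hx Hy]]. simpl in *.
    exists (RInt f x y). split; [|exact HPxy].
    apply (RInt_correct (V := R_CompleteNormedModule)).
    apply ex_RInt_inside; [exact Hf| |]; lra.
Qed.

End OpenInterval.

(* If x g(x) stayed above eps near 0, then g would dominate eps / x and not be
   integrable; the bound on f is the Cauchy-Schwarz inequality on (0, x). *)
Lemma boundary_point (X : R) (G g : R -> R) :
  0 < X ->
  (forall x, 0 < x < X -> is_derive G x (g x)) ->
  (forall eps, 0 < eps -> exists d, 0 < d /\
     forall x y, 0 < x < d -> 0 < y < d -> Rabs (G x - G y) < eps) ->
  forall eps d, 0 < eps -> 0 < d ->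
  exists x, 0 < x < d /\ x < X /\ x * g x <= eps /\
    forall f df, filterlim f (at_right 0) (locally 0) ->
      (forall y, 0 < y < X -> is_derive f y (df y)) ->
      (forall y, 0 < y < X -> df y ^ 2 <= g y) -> f x ^ 2 <= eps * x.
Proof.
  intros hX HG HC eps d heps hd.
  destruct (HC eps heps) as [d1 [hd1 Hd1]].
  set (D := Rmin d (Rmin d1 X)).
  assert (hD : 0 < D /\ D <= d /\ D <= d1 /\ D <= X).
  { unfold D. pose proof (Rmin_l d (Rmin d1 X)). pose proof (Rmin_r d (Rmin d1 X)).
    pose proof (Rmin_l d1 X). pose proof (Rmin_r d1 X).
    repeat split; try lra. repeat apply Rmin_glb_lt; lra. }
  assert (Hx : exists x, 0 < x < D /\ x * g x <= eps).
  { destruct (classic (exists x, 0 < x < D /\ x * g x <= eps)) as [h|h]; [exact h|exfalso].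
    set (b := D / 2). set (a := b * exp (- 2)).
    assert (hexp : 0 < exp (- 2) < 1).
    { split; [apply exp_pos|]. rewrite <- exp_0. apply exp_increasing. lra. }
    assert (hab : 0 < a < b) by (unfold a, b; split; nra).
    assert (Hle : G a - eps * ln a <= G b - eps * ln b).
    { apply (derive_nonneg_le (fun t => G t - eps * ln t) (fun t => g t - eps * / t));
        [lra| |].
      - intros t Ht. apply (is_derive_minus G (fun t => eps * ln t)).
        + apply HG. unfold b in *. lra.
        + apply is_derive_scal. apply is_derive_Reals, derivable_pt_lim_ln. lra.
      - intros t Ht. assert (Ht' : eps < t * g t).
        { apply Rnot_le_lt. intros hle. apply h. exists t. unfold b in *. lra. }
        assert (0 < / t) by (apply Rinv_0_lt_compat; lra).
        assert (eps * / t < t * g t * / t) by (apply Rmult_lt_compat_r; lra).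
        replace (t * g t * / t) with (g t) in * by (field; lra). lra. }
    assert (Ela : ln a = ln b - 2).
    { unfold a. rewrite ln_mult, ln_exp by lra. ring. }
    pose proof (Hd1 b a ltac:(unfold b in *; lra) ltac:(unfold b in *; lra)) as HGab.
    apply Rabs_def2 in HGab. rewrite Ela in Hle. lra. }
  destruct Hx as [x [Hx Hgx]].
  exists x. repeat split; try lra.
  intros f df Hf0 Hdf Hfg.
  assert (Hinc : forall y, 0 < y < x -> (f x - f y) ^ 2 <= eps * x).
  { intros y Hy. set (k := (f x - f y) / (x - y)).
    assert (Hk : k ^ 2 * y + G y - 2 * k * f y <= k ^ 2 * x + G x - 2 * k * f x).
    { apply (derive_nonneg_le (fun t => k ^ 2 * t + G t - 2 * k * f t)
        (fun t => k ^ 2 + g t - 2 * k * df t)); [lra| |].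
      - intros t Ht. apply (is_derive_minus (fun t => k ^ 2 * t + G t) (fun t => 2 * k * f t)).
        + apply (is_derive_plus (fun t => k ^ 2 * t) G); [|apply HG; lra].
          auto_derive; [auto|ring].
        + apply is_derive_scal, Hdf. lra.
      - intros t Ht. pose proof (Hfg t ltac:(lra)). pose proof (pow2_ge_0 (k - df t)). nra. }
    pose proof (Hd1 x y ltac:(lra) ltac:(lra)) as HGxy. apply Rabs_def2 in HGxy.
    assert (Ek : f x - f y = k * (x - y)) by (unfold k; field; lra).
    assert (H1 : k ^ 2 * (x - y) <= eps) by nra.
    rewrite Ek. replace ((k * (x - y)) ^ 2) with (k ^ 2 * (x - y) * (x - y)) by ring.
    pose proof (pow2_ge_0 k). nra. }
  set (s := sqrt (eps * x)).
  assert (hs : 0 <= s) by apply sqrt_pos.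
  assert (Es : s ^ 2 = eps * x) by (apply pow2_sqrt; nra).
  assert (Hfs : Rabs (f x) <= s).
  { apply le_epsilon. intros e he.
    destruct (proj1 (at_right_eps f 0 0) Hf0 e he) as [d2 [hd2 Hd2]].
    set (y := Rmin (d2 / 2) (x / 2)).
    assert (hy : 0 < y /\ y <= d2 / 2 /\ y <= x / 2).
    { unfold y. repeat split; [apply Rmin_glb_lt; lra|apply Rmin_l|apply Rmin_r]. }
    pose proof (Hd2 y ltac:(lra)) as Hfy. rewrite Rminus_0_r in Hfy.
    assert (Hd : Rabs (f x - f y) <= s).
    { apply Rnot_lt_le. intros hlt. pose proof (Hinc y ltac:(lra)) as Hi.
      rewrite <- (pow2_abs (f x - f y)) in Hi. nra. }
    replace (f x) with ((f x - f y) + f y) by ring.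
    eapply Rle_trans; [apply Rabs_triang|]. lra. }
  rewrite <- (pow2_abs (f x)), <- Es. pose proof (Rabs_pos (f x)). nra.
Qed.

Lemma boundary_point_right (X : R) (G g : R -> R) :
  0 < X ->
  (forall x, 0 < x < X -> is_derive G x (g x)) ->
  (forall eps, 0 < eps -> exists d, 0 < d /\
     forall x y, X - d < x < X -> X - d < y < X -> Rabs (G x - G y) < eps) ->
  forall eps d, 0 < eps -> 0 < d ->
  exists x, X - d < x < X /\ 0 < x /\ (X - x) * g x <= eps /\
    forall f df, filterlim f (at_left X) (locally 0) ->
      (forall y, 0 < y < X -> is_derive f y (df y)) ->
      (forall y, 0 < y < X -> df y ^ 2 <= g y) -> f x ^ 2 <= eps * (X - x).
Proof.
  intros hX HG HC eps d heps hd.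
  assert (Hrefl : forall (h dh : R -> R) x, 0 < x < X ->
    (forall y, 0 < y < X -> is_derive h y (dh y)) ->
    is_derive (fun t => h (X - t)) x (- dh (X - x))).
  { intros h dh x Hx Hh. replace (- dh (X - x)) with ((-1) * dh (X - x)) by ring.
    apply (is_derive_comp (K := R_AbsRing) (V := R_NormedModule) h (fun t => X - t)).
    - apply Hh; lra.
    - auto_derive; [auto|ring]. }
  destruct (boundary_point X (fun t => - G (X - t)) (fun t => g (X - t)) hX)
    with (eps := eps) (d := d) as [x [Hx [hxX [Hgx Hf]]]]; try assumption.
  - intros x Hx. replace (g (X - x)) with (- - g (X - x)) by ring.
    apply (is_derive_opp (fun t => G (X - t))). now apply Hrefl.
  - intros e he. destruct (HC e he) as [d1 [hd1 Hd1]]. exists d1.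
    split; [assumption|]. intros x y Hx Hy.
    replace (- G (X - x) - - G (X - y)) with (G (X - y) - G (X - x)) by ring.
    apply Hd1; lra.
  - exists (X - x). replace (X - (X - x)) with x by ring.
    repeat split; try lra.
    intros f df Hf0 Hdf Hfg.
    apply (Hf (fun t => f (X - t)) (fun t => - df (X - t))).
    + apply at_right_eps. intros e he.
      destruct (proj1 (at_left_eps f X 0) Hf0 e he) as [d1 [hd1 Hd1]].
      exists d1. split; [assumption|]. intros t Ht. apply Hd1; lra.
    + intros y Hy. now apply Hrefl.
    + intros y Hy. replace ((- df (X - y)) ^ 2) with (df (X - y) ^ 2) by ring.
      apply Hfg; lra.
Qed.

(** * Stability of the reduced operator *)

Lemma filterlim_fst_snd (F : (R -> Prop) -> Prop) (v : R -> R * R) (a b : R) :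
  filterlim v F (locally (a, b)) ->
  filterlim (fun x => fst (v x)) F (locally a) /\
  filterlim (fun x => snd (v x)) F (locally b).
Proof.
  intros H; split.
  - apply (filterlim_comp _ _ _ v fst _ _ _ H).
    apply filterlim_locally. intros eps. exists eps. intros y [Hy _]. exact Hy.
  - apply (filterlim_comp _ _ _ v snd _ _ _ H).
    apply filterlim_locally. intros eps. exists eps. intros y [_ Hy]. exact Hy.
Qed.

Lemma C2_on_derives (X : R) (f : R -> R) :
  C2_on X f -> forall x, 0 < x < X ->
    is_derive f x (Derive f x) /\
    is_derive (Derive f) x (Derive (Derive f) x) /\
    continuous f x /\ continuous (Derive f) x /\ continuous (Derive (Derive f)) x.
Proof.
  intros H x Hx.
  destruct (H 0%nat x ltac:(lia) Hx) as [_ H0].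
  destruct (H 1%nat x ltac:(lia) Hx) as [D1 H1].
  destruct (H 2%nat x ltac:(lia) Hx) as [D2 H2].
  repeat split; try assumption; apply Derive_correct; assumption.
Qed.

Section Pairing.

Variables (X : R) (a e1 e2 e3 e4 z12 z21 : R -> R).

Definition pert_op (v : R -> R * R) (x : R) : R * R :=
  let dv := dstar v x in
  let ddv := dstar (dstar v) x in
  (- fst ddv + 2 * a x * snd dv + (e1 x * fst (v x) + e2 x * snd (v x)),
   - snd ddv - 2 * a x * fst dv + (e3 x * fst (v x) + e4 x * snd (v x))).

Definition pert_admissible (v : R -> R * R) : Prop :=
  C2_on X (fun x => fst (v x)) /\ C2_on X (fun x => snd (v x)) /\
  filterlim v (at_right 0) (locally (0, 0)) /\
  filterlim v (at_left X) (locally (0, 0)) /\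
  square_integrable X v /\
  square_integrable X (dstar v) /\
  square_integrable X (pert_op v).

Definition dot (u v : R -> R * R) (x : R) : R :=
  fst (u x) * fst (v x) + snd (u x) * snd (v x).

(* Completing the square in dot u (pert_op v) with the antiderivatives z12 of
   e2 and z21 of e3 leaves this form plus the derivative of [pert_bdry]. *)
Definition pert_quad (u v : R -> R * R) (x : R) : R :=
  (fst (dstar u x) - z12 x * snd (u x)) * (fst (dstar v x) - z12 x * snd (v x))
  + (snd (dstar u x) - z21 x * fst (u x)) * (snd (dstar v x) - z21 x * fst (v x))
  + (e1 x - z21 x ^ 2) * (fst (u x) * fst (v x))
  + (e4 x - z12 x ^ 2) * (snd (u x) * snd (v x)).

Definition pert_bdry (u v : R -> R * R) (x : R) : R :=
  - dot u (dstar v) x + z12 x * (fst (u x) * snd (v x))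
  + z21 x * (snd (u x) * fst (v x)).

Hypothesis hX : 0 < X.
Hypothesis Hz12 : forall x, 0 < x < X -> is_derive z12 x (e2 x).
Hypothesis Hz21 : forall x, 0 < x < X -> is_derive z21 x (e3 x).
Hypothesis Ha : forall x, 0 < x < X -> 2 * a x = z12 x - z21 x.
Hypothesis Hac : forall x, 0 < x < X -> continuous a x.
Hypothesis He1 : forall x, 0 < x < X -> continuous e1 x.
Hypothesis He2 : forall x, 0 < x < X -> continuous e2 x.
Hypothesis He3 : forall x, 0 < x < X -> continuous e3 x.
Hypothesis He4 : forall x, 0 < x < X -> continuous e4 x.
Variable zb : R.
Hypothesis hzb : forall x, 0 < x < X -> Rabs (z12 x) <= zb /\ Rabs (z21 x) <= zb.

Lemma pert_bdry_derive (u v : R -> R * R) (x : R) :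
  pert_admissible u -> pert_admissible v -> 0 < x < X ->
  is_derive (pert_bdry u v) x (dot u (pert_op v) x - pert_quad u v x).
Proof.
  intros [Hu1 [Hu2 _]] [Hv1 [Hv2 _]] Hx.
  destruct (C2_on_derives X _ Hu1 x Hx) as [U1 _].
  destruct (C2_on_derives X _ Hu2 x Hx) as [U2 _].
  destruct (C2_on_derives X _ Hv1 x Hx) as [V1 [V1' _]].
  destruct (C2_on_derives X _ Hv2 x Hx) as [V2 [V2' _]].
  pose proof (Hz12 x Hx) as Z1. pose proof (Hz21 x Hx) as Z2. pose proof (Ha x Hx) as A.
  unfold pert_bdry, dot, pert_quad, pert_op, dstar; cbn [fst snd].
  set (u1 := fun x => fst (u x)) in *. set (u2 := fun x => snd (u x)) in *.
  set (v1 := fun x => fst (v x)) in *. set (v2 := fun x => snd (v x)) in *.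
  change (is_derive (fun x => - (u1 x * Derive v1 x + u2 x * Derive v2 x)
    + z12 x * (u1 x * v2 x) + z21 x * (u2 x * v1 x)) x
   (u1 x * (- Derive (Derive v1) x + 2 * a x * Derive v2 x + (e1 x * v1 x + e2 x * v2 x))
    + u2 x * (- Derive (Derive v2) x - 2 * a x * Derive v1 x + (e3 x * v1 x + e4 x * v2 x))
    - ((Derive u1 x - z12 x * u2 x) * (Derive v1 x - z12 x * v2 x)
       + (Derive u2 x - z21 x * u1 x) * (Derive v2 x - z21 x * v1 x)
       + (e1 x - z21 x ^ 2) * (u1 x * v1 x) + (e4 x - z12 x ^ 2) * (u2 x * v2 x)))).
  clearbody u1 u2 v1 v2.
  eapply is_derive_eq.
  - apply is_derive_Rplus; [apply is_derive_Rplus; [apply is_derive_Ropp, is_derive_Rplus|]|].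
    + exact (is_derive_Rmult _ _ _ _ _ U1 V1').
    + exact (is_derive_Rmult _ _ _ _ _ U2 V2').
    + exact (is_derive_Rmult _ _ _ _ _ Z1 (is_derive_Rmult _ _ _ _ _ U1 V2)).
    + exact (is_derive_Rmult _ _ _ _ _ Z2 (is_derive_Rmult _ _ _ _ _ U2 V1)).
  - rewrite A. ring.
Qed.

Lemma admissible_continuous (u : R -> R * R) (x : R) :
  pert_admissible u -> 0 < x < X ->
  (continuous (fun t => fst (u t)) x /\ continuous (fun t => snd (u t)) x) /\
  (continuous (fun t => fst (dstar u t)) x /\ continuous (fun t => snd (dstar u t)) x) /\
  (continuous (fun t => fst (pert_op u t)) x /\ continuous (fun t => snd (pert_op u t)) x).
Proof.
  intros [H1 [H2 _]] Hx.
  destruct (C2_on_derives X _ H1 x Hx) as [_ [_ [A0 [A1 A2]]]].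
  destruct (C2_on_derives X _ H2 x Hx) as [_ [_ [B0 [B1 B2]]]].
  pose proof (Hac x Hx). pose proof (He1 x Hx). pose proof (He2 x Hx).
  pose proof (He3 x Hx). pose proof (He4 x Hx).
  split; [now split|]. split; [now split|].
  unfold pert_op, dstar; cbn [fst snd]; split; cont.
Qed.

Lemma ex_RInt_gen_dot (u v : R -> R * R) :
  (forall x, 0 < x < X -> continuous (fun t => fst (u t)) x /\ continuous (fun t => snd (u t)) x) ->
  (forall x, 0 < x < X -> continuous (fun t => fst (v t)) x /\ continuous (fun t => snd (v t)) x) ->
  square_integrable X u -> square_integrable X v ->
  ex_RInt_gen (dot u v) (at_right 0) (at_left X).
Proof.
  intros Hu Hv [lu Iu] [lv Iv].
  apply (ex_RInt_gen_dominated X hX _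
    (fun x => (fst (u x) ^ 2 + snd (u x) ^ 2) + (fst (v x) ^ 2 + snd (v x) ^ 2))).
  - intros x Hx. destruct (Hu x Hx), (Hv x Hx).
    apply cont_Rplus; now apply cont_Rmult.
  - intros x Hx. destruct (Hu x Hx), (Hv x Hx).
    repeat apply cont_Rplus; now apply cont_Rpow.
  - intros x Hx. unfold dot. apply Rabs_le.
    pose proof (pow2_ge_0 (fst (u x) + fst (v x))). pose proof (pow2_ge_0 (snd (u x) + snd (v x))).
    pose proof (pow2_ge_0 (fst (u x) - fst (v x))). pose proof (pow2_ge_0 (snd (u x) - snd (v x))).
    nra.
  - exists (lu + lv).
    exact (is_RInt_gen_plus (fun x => fst (u x) ^ 2 + snd (u x) ^ 2)
             (fun x => fst (v x) ^ 2 + snd (v x) ^ 2) lu lv Iu Iv).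
Qed.

Lemma pert_bdry_bound (u v : R -> R * R) (x w m : R) :
  0 < w <= X -> 0 < x < X -> 0 < m ->
  w * ((fst (dstar u x) ^ 2 + snd (dstar u x) ^ 2)
       + (fst (dstar v x) ^ 2 + snd (dstar v x) ^ 2)) <= m ->
  fst (u x) ^ 2 <= m * w -> snd (u x) ^ 2 <= m * w ->
  fst (v x) ^ 2 <= m * w -> snd (v x) ^ 2 <= m * w ->
  Rabs (pert_bdry u v x) <= m * (2 + 2 * zb * X).
Proof.
  intros Hw Hx hm Hg U1 U2 V1 V2.
  destruct (hzb x Hx) as [hz1 hz2].
  assert (hzb0 : 0 <= zb) by (pose proof (Rabs_pos (z12 x)); lra).
  assert (HP : forall p q, p ^ 2 <= m * w -> w * q ^ 2 <= m -> Rabs (p * q) <= m).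
  { intros p q Hp Hq. apply Rabs_le.
    assert (Hpq : (p * q) ^ 2 <= m ^ 2).
    { replace ((p * q) ^ 2) with (p ^ 2 * q ^ 2) by ring.
      pose proof (pow2_ge_0 q).
      assert (p ^ 2 * q ^ 2 <= m * w * q ^ 2) by (apply Rmult_le_compat_r; lra). nra. }
    split; apply Rnot_lt_le; intros h; nra. }
  assert (HZ : forall z p q, Rabs z <= zb -> p ^ 2 <= m * w -> q ^ 2 <= m * w ->
            Rabs (z * (p * q)) <= zb * (m * X)).
  { intros z p q Hz Hp Hq. rewrite Rabs_mult.
    apply Rmult_le_compat; try apply Rabs_pos; [exact Hz|].
    apply Rle_trans with (m * w); [|apply Rmult_le_compat_l; lra].
    apply Rabs_le. pose proof (pow2_ge_0 (p + q)). pose proof (pow2_ge_0 (p - q)). lra. }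
  pose proof (pow2_ge_0 (fst (dstar u x))). pose proof (pow2_ge_0 (snd (dstar u x))).
  pose proof (pow2_ge_0 (fst (dstar v x))). pose proof (pow2_ge_0 (snd (dstar v x))).
  pose proof (HP _ (fst (dstar v x)) U1 ltac:(nra)) as B1.
  pose proof (HP _ (snd (dstar v x)) U2 ltac:(nra)) as B2.
  pose proof (HZ _ _ _ hz1 U1 V2) as B3. pose proof (HZ _ _ _ hz2 U2 V1) as B4.
  unfold pert_bdry, dot.
  apply Rabs_le_between in B1, B2, B3, B4. apply Rabs_le_between. lra.
Qed.

Lemma pert_quad_continuous (u v : R -> R * R) (x : R) :
  pert_admissible u -> pert_admissible v -> 0 < x < X -> continuous (pert_quad u v) x.
Proof.
  intros Hu Hv Hx.
  destruct (admissible_continuous u x Hu Hx) as [[A0 A1] [[A2 A3] _]].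
  destruct (admissible_continuous v x Hv Hx) as [[B0 B1] [[B2 B3] _]].
  assert (C1 : continuous z12 x)
    by (apply (ex_derive_continuous (V := R_NormedModule)); exists (e2 x); auto).
  assert (C2 : continuous z21 x)
    by (apply (ex_derive_continuous (V := R_NormedModule)); exists (e3 x); auto).
  pose proof (He1 x Hx). pose proof (He4 x Hx). unfold pert_quad. cont.
Qed.

Lemma dot_pert_op_continuous (u v : R -> R * R) (x : R) :
  pert_admissible u -> pert_admissible v -> 0 < x < X -> continuous (dot u (pert_op v)) x.
Proof.
  intros Hu Hv Hx.
  destruct (admissible_continuous u x Hu Hx) as [[A0 A1] _].
  destruct (admissible_continuous v x Hv Hx) as [_ [_ [B2 B3]]].
  apply cont_Rplus; now apply cont_Rmult.
Qed.

Lemma RInt_dot_pert_op (u v : R -> R * R) (x y : R) :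
  pert_admissible u -> pert_admissible v -> 0 < x < X -> 0 < y < X ->
  RInt (dot u (pert_op v)) x y
    = RInt (pert_quad u v) x y + (pert_bdry u v y - pert_bdry u v x).
Proof.
  intros Hu Hv Hx Hy.
  assert (E : RInt (fun t => dot u (pert_op v) t - pert_quad u v t) x y
              = pert_bdry u v y - pert_bdry u v x).
  { apply is_RInt_unique. apply (is_RInt_derive (pert_bdry u v)).
    - intros t Ht. apply pert_bdry_derive; try assumption.
      pose proof (Rmin_glb_lt x y 0 ltac:(lra) ltac:(lra)).
      pose proof (Rmax_lub_lt x y X ltac:(lra) ltac:(lra)). lra.
    - intros t Ht.
      pose proof (Rmin_glb_lt x y 0 ltac:(lra) ltac:(lra)).
      pose proof (Rmax_lub_lt x y X ltac:(lra) ltac:(lra)).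
      apply cont_Rminus; [apply dot_pert_op_continuous|apply pert_quad_continuous]; auto; lra. }
  rewrite <- E.
  rewrite (RInt_minus (V := R_CompleteNormedModule) (dot u (pert_op v)) (pert_quad u v)).
  - change (RInt (dot u (pert_op v)) x y = RInt (pert_quad u v) x y +
      (RInt (dot u (pert_op v)) x y - RInt (pert_quad u v) x y)).
    symmetry; apply Rplus_minus.
  - apply (ex_RInt_inside X); auto. intros; now apply dot_pert_op_continuous.
  - apply (ex_RInt_inside X); auto. intros; now apply pert_quad_continuous.
Qed.

Lemma inner_approx (u v : R -> R * R) (eps d : R) :
  pert_admissible u -> pert_admissible v -> 0 < eps -> 0 < d ->
  exists x y, (0 < x < d /\ x < X) /\ (X - d < y < X /\ 0 < y) /\
    Rabs (inner X u (pert_op v) - RInt (pert_quad u v) x y) < eps /\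
    Rabs (inner X v (pert_op u) - RInt (pert_quad v u) x y) < eps.
Proof.
  intros Hu Hv heps hd.
  assert (Hin : forall p q, pert_admissible p -> pert_admissible q -> exists d0, 0 < d0 /\
    forall x y, 0 < x < d0 -> x < X -> X - d0 < y < X -> 0 < y ->
      Rabs (inner X p (pert_op q) - RInt (dot p (pert_op q)) x y) < eps / 2).
  { intros p q Hp Hq.
    destruct (ex_RInt_gen_dot p (pert_op q)) as [l Hl].
    - intros x Hx. now apply (admissible_continuous p x).
    - intros x Hx. now apply (admissible_continuous q x).
    - apply Hp.
    - apply Hq.
    - assert (E : inner X p (pert_op q) = l) by (apply is_RInt_gen_unique, Hl).
      destruct (RInt_gen_eps _ _ _ _ Hl (eps / 2)) as [d0 [hd0 Hd0]]; [lra|].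
      exists d0. split; [assumption|]. intros x y Hx _ Hy _.
      destruct (Hd0 x y) as [I [HI HIl]]; [lra|lra|].
      rewrite E, (is_RInt_unique _ _ _ _ HI), Rabs_minus_sym. exact HIl. }
  destruct (Hin u v Hu Hv) as [d1 [hd1 Hd1]].
  destruct (Hin v u Hv Hu) as [d2 [hd2 Hd2]].
  set (D := Rmin d (Rmin d1 d2)).
  assert (hD : 0 < D /\ D <= d /\ D <= d1 /\ D <= d2).
  { unfold D. pose proof (Rmin_l d (Rmin d1 d2)). pose proof (Rmin_r d (Rmin d1 d2)).
    pose proof (Rmin_l d1 d2). pose proof (Rmin_r d1 d2).
    repeat split; try lra. repeat apply Rmin_glb_lt; lra. }
  assert (hzb0 : 0 <= zb).
  { destruct (hzb (X / 2)) as [h _]; [lra|]. pose proof (Rabs_pos (z12 (X / 2))). lra. }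
  set (m := eps / 8 / (2 + 2 * zb * X)).
  assert (hK : 0 < 2 + 2 * zb * X) by nra.
  assert (hm : 0 < m) by (apply Rdiv_lt_0_compat; lra).
  assert (Em : m * (2 + 2 * zb * X) = eps / 8) by (unfold m; field; lra).
  set (g := fun x => (fst (dstar u x) ^ 2 + snd (dstar u x) ^ 2)
                     + (fst (dstar v x) ^ 2 + snd (dstar v x) ^ 2)).
  assert (Hgc : forall x, 0 < x < X -> continuous g x).
  { intros x Hx.
    destruct (admissible_continuous u x Hu Hx) as [_ [[A2 A3] _]].
    destruct (admissible_continuous v x Hv Hx) as [_ [[B2 B3] _]].
    repeat apply cont_Rplus; now apply cont_Rpow. }
  assert (Hgi : ex_RInt_gen g (at_right 0) (at_left X)).
  { destruct Hu as [_ [_ [_ [_ [_ [[lu Iu] _]]]]]].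
    destruct Hv as [_ [_ [_ [_ [_ [[lv Iv] _]]]]]].
    exists (lu + lv).
    exact (is_RInt_gen_plus (fun x => fst (dstar u x) ^ 2 + snd (dstar u x) ^ 2)
             (fun x => fst (dstar v x) ^ 2 + snd (dstar v x) ^ 2) lu lv Iu Iv). }
  pose proof (primitive_cauchy X hX g Hgc Hgi) as HC.
  destruct (boundary_point X (fun t => RInt g (X / 2) t) g hX) with (eps := m) (d := D)
    as [x [Hx [hxX [Hgx Hfx]]]]; [|  |lra|lra|].
  { intros; now apply is_derive_inside_primitive. }
  { intros e he. destruct (HC e he) as [d0 [hd0 [H0 _]]]. exists d0. split; [lra|exact H0]. }
  destruct (boundary_point_right X (fun t => RInt g (X / 2) t) g hX) with (eps := m) (d := D)
    as [y [Hy [hy0 [Hgy Hfy]]]]; [|  |lra|lra|].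
  { intros; now apply is_derive_inside_primitive. }
  { intros e he. destruct (HC e he) as [d0 [hd0 [_ H0]]]. exists d0. split; [lra|exact H0]. }
  exists x, y. split; [lra|]. split; [lra|].
  assert (Hends : forall p, pert_admissible p ->
    (forall t, fst (dstar p t) ^ 2 <= g t /\ snd (dstar p t) ^ 2 <= g t) ->
    (fst (p x) ^ 2 <= m * x /\ snd (p x) ^ 2 <= m * x) /\
    (fst (p y) ^ 2 <= m * (X - y) /\ snd (p y) ^ 2 <= m * (X - y))).
  { intros p [H1 [H2 [L0 [LX _]]]] Hpg.
    destruct (filterlim_fst_snd _ _ _ _ L0) as [L01 L02].
    destruct (filterlim_fst_snd _ _ _ _ LX) as [LX1 LX2].
    repeat split.
    - apply (Hfx (fun t => fst (p t)) (fun t => fst (dstar p t)) L01).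
      + intros t Ht. now apply (C2_on_derives X _ H1).
      + intros; apply Hpg.
    - apply (Hfx (fun t => snd (p t)) (fun t => snd (dstar p t)) L02).
      + intros t Ht. now apply (C2_on_derives X _ H2).
      + intros; apply Hpg.
    - apply (Hfy (fun t => fst (p t)) (fun t => fst (dstar p t)) LX1).
      + intros t Ht. now apply (C2_on_derives X _ H1).
      + intros; apply Hpg.
    - apply (Hfy (fun t => snd (p t)) (fun t => snd (dstar p t)) LX2).
      + intros t Ht. now apply (C2_on_derives X _ H2).
      + intros; apply Hpg. }
  assert (Hsq : forall t, 0 <= fst (dstar u t) ^ 2 /\ 0 <= snd (dstar u t) ^ 2 /\
    0 <= fst (dstar v t) ^ 2 /\ 0 <= snd (dstar v t) ^ 2).
  { intros t; repeat split; apply pow2_ge_0. }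
  destruct (Hends u Hu) as [[Ux1 Ux2] [Uy1 Uy2]].
  { intros t. unfold g. pose proof (Hsq t). lra. }
  destruct (Hends v Hv) as [[Vx1 Vx2] [Vy1 Vy2]].
  { intros t. unfold g. pose proof (Hsq t). lra. }
  unfold g in Hgx, Hgy.
  assert (Hb : forall p q, (p = u /\ q = v) \/ (p = v /\ q = u) ->
    Rabs (pert_bdry p q x) <= eps / 8 /\ Rabs (pert_bdry p q y) <= eps / 8).
  { intros p q [[-> ->]|[-> ->]]; rewrite <- Em; split.
    - apply pert_bdry_bound with x; auto; lra.
    - apply pert_bdry_bound with (X - y); auto; lra.
    - apply pert_bdry_bound with x; auto; lra.
    - apply pert_bdry_bound with (X - y); auto; lra. }
  destruct (Hb u v) as [B1 B2]; [auto|]. destruct (Hb v u) as [B3 B4]; [auto|].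
  pose proof (Hd1 x y ltac:(lra) ltac:(lra) ltac:(lra) ltac:(lra)) as I1.
  pose proof (Hd2 x y ltac:(lra) ltac:(lra) ltac:(lra) ltac:(lra)) as I2.
  rewrite RInt_dot_pert_op in I1, I2 by (assumption || lra).
  apply Rabs_def2 in I1, I2. apply Rabs_le_between in B1, B2, B3, B4.
  split; apply Rabs_def1; lra.
Qed.

Lemma dot_comm (u v : R -> R * R) : dot u v = dot v u.
Proof. apply functional_extensionality. intros x. unfold dot. ring. Qed.

Lemma pert_quad_comm (u v : R -> R * R) : pert_quad u v = pert_quad v u.
Proof. apply functional_extensionality. intros x. unfold pert_quad. ring. Qed.

Theorem pert_op_symmetric (u v : R -> R * R) :
  pert_admissible u -> pert_admissible v ->
  inner X u (pert_op v) = inner X (pert_op u) v.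
Proof.
  intros Hu Hv.
  assert (E : inner X (pert_op u) v = inner X v (pert_op u)).
  { unfold inner. fold (dot (pert_op u) v). fold (dot v (pert_op u)).
    now rewrite dot_comm. }
  rewrite E.
  assert (H : Rabs (inner X u (pert_op v) - inner X v (pert_op u)) <= 0).
  { apply le_epsilon. intros eps heps.
    destruct (inner_approx u v (eps / 2) 1 Hu Hv) as [x [y [_ [_ [H1 H2]]]]]; [lra|lra|].
    rewrite (pert_quad_comm v u) in H2. apply Rabs_def2 in H1, H2.
    apply Rabs_le; lra. }
  pose proof (Rabs_pos (inner X u (pert_op v) - inner X v (pert_op u))).
  apply Rminus_diag_uniq. destruct (Req_dec (inner X u (pert_op v) - inner X v (pert_op u)) 0)
    as [e|e]; [exact e|]. pose proof (Rabs_pos_lt _ e). lra.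
Qed.

Theorem pert_op_positive (v : R -> R * R) :
  (forall x, 0 < x < X -> 0 < e1 x - z21 x ^ 2 /\ 0 < e4 x - z12 x ^ 2) ->
  pert_admissible v -> (exists x, 0 < x < X /\ v x <> (0, 0)) ->
  0 < inner X v (pert_op v).
Proof.
  intros HK Hv [x0 [Hx0 Hne]].
  pose proof (fun x Hx => pert_quad_continuous v v x Hv Hv Hx) as Hqc.
  assert (Hq0 : forall x, 0 < x < X -> 0 <= pert_quad v v x).
  { intros x Hx. destruct (HK x Hx). unfold pert_quad.
    pose proof (Rle_0_sqr (fst (dstar v x) - z12 x * snd (v x))) as S1.
    pose proof (Rle_0_sqr (snd (dstar v x) - z21 x * fst (v x))) as S2.
    pose proof (Rle_0_sqr (fst (v x))) as S3. pose proof (Rle_0_sqr (snd (v x))) as S4.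
    unfold Rsqr in *.
    pose proof (Rmult_le_pos (e1 x - z21 x ^ 2) _ ltac:(lra) S3).
    pose proof (Rmult_le_pos (e4 x - z12 x ^ 2) _ ltac:(lra) S4). lra. }
  assert (Hqp : 0 < pert_quad v v x0).
  { destruct (HK x0 Hx0). unfold pert_quad.
    pose proof (Rle_0_sqr (fst (dstar v x0) - z12 x0 * snd (v x0))) as S1.
    pose proof (Rle_0_sqr (snd (dstar v x0) - z21 x0 * fst (v x0))) as S2.
    pose proof (Rle_0_sqr (fst (v x0))) as S3. pose proof (Rle_0_sqr (snd (v x0))) as S4.
    unfold Rsqr in *.
    pose proof (Rmult_le_pos (e1 x0 - z21 x0 ^ 2) _ ltac:(lra) S3).
    pose proof (Rmult_le_pos (e4 x0 - z12 x0 ^ 2) _ ltac:(lra) S4).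
    destruct (Req_dec (fst (v x0)) 0) as [n1|n1].
    - assert (n2 : snd (v x0) <> 0).
      { intros n2. apply Hne. rewrite (surjective_pairing (v x0)), n1, n2. reflexivity. }
      pose proof (Rsqr_pos_lt _ n2). unfold Rsqr in *.
      pose proof (Rmult_lt_0_compat (e4 x0 - z12 x0 ^ 2) (snd (v x0) * snd (v x0))
        ltac:(lra) ltac:(lra)). lra.
    - pose proof (Rsqr_pos_lt _ n1). unfold Rsqr in *.
      pose proof (Rmult_lt_0_compat (e1 x0 - z21 x0 ^ 2) (fst (v x0) * fst (v x0))
        ltac:(lra) ltac:(lra)). lra. }
  set (P := fun y => RInt (pert_quad v v) (X / 2) y).
  assert (HP : forall x, 0 < x < X -> is_derive P x (pert_quad v v x)).
  { intros x Hx. exact (is_derive_inside_primitive X hX _ x Hqc Hx). }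
  destruct (proj1 (filterlim_locally _ _) (Hqc x0 Hx0)
    (mkposreal (pert_quad v v x0) Hqp)) as [d0 Hd0].
  set (r := Rmin (d0 / 2) (Rmin (x0 / 2) ((X - x0) / 2))).
  assert (hr : 0 < r /\ r < d0 /\ r < x0 /\ r < X - x0).
  { pose proof (cond_pos d0). unfold r.
    pose proof (Rmin_l (d0 / 2) (Rmin (x0 / 2) ((X - x0) / 2))).
    pose proof (Rmin_r (d0 / 2) (Rmin (x0 / 2) ((X - x0) / 2))).
    pose proof (Rmin_l (x0 / 2) ((X - x0) / 2)). pose proof (Rmin_r (x0 / 2) ((X - x0) / 2)).
    repeat split; try lra. repeat apply Rmin_glb_lt; lra. }
  assert (Hc : P (x0 - r) < P (x0 + r)).
  { apply (derive_pos_lt P (pert_quad v v)); [lra| |].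
    - intros t Ht. apply HP; lra.
    - intros t Ht. assert (Ht' : Rabs (pert_quad v v t - pert_quad v v x0) < pert_quad v v x0).
      { apply (Hd0 t). change (Rabs (t - x0) < d0). apply Rabs_def1; lra. }
      apply Rabs_def2 in Ht'. lra. }
  set (c := P (x0 + r) - P (x0 - r)) in *.
  set (d := Rmin (x0 - r) (X - x0 - r)).
  assert (hd : 0 < d /\ d <= x0 - r /\ d <= X - x0 - r).
  { unfold d. repeat split; [apply Rmin_glb_lt; lra|apply Rmin_l|apply Rmin_r]. }
  destruct (inner_approx v v c d Hv Hv) as [x [y [Hx [Hy [H1 _]]]]]; [unfold c; lra|lra|].
  rewrite (RInt_inside_primitive X hX) in H1 by (assumption || lra).
  fold (P x) (P y) in H1. apply Rabs_def2 in H1.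
  assert (P x <= P (x0 - r)).
  { apply (derive_nonneg_le P (pert_quad v v)); [lra| |]; intros t Ht;
      [apply HP|apply Hq0]; lra. }
  assert (P (x0 + r) <= P y).
  { apply (derive_nonneg_le P (pert_quad v v)); [lra| |]; intros t Ht;
      [apply HP|apply Hq0]; lra. }
  unfold c in H1. lra.
Qed.

End Pairing.

(** * Behaviour at the origin *)

Definition has_lim0 (f : R -> R) : Prop :=
  exists l : R, filterlim f (at_right 0) (locally l).

Lemma lim0_ext (f g : R -> R) (l : R) :
  (forall r, 0 < r -> f r = g r) ->
  filterlim f (at_right 0) (locally l) -> filterlim g (at_right 0) (locally l).
Proof.
  intros E H. apply at_right_eps. intros eps heps.
  destruct (proj1 (at_right_eps f 0 l) H eps heps) as [d [hd Hd]].
  exists d. split; [assumption|]. intros x Hx. rewrite <- E by lra. now apply Hd.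
Qed.

Lemma has_lim0_ext (f g : R -> R) :
  (forall r, 0 < r -> f r = g r) -> has_lim0 f -> has_lim0 g.
Proof. intros E [l Hl]. exists l. now apply lim0_ext with f. Qed.

Lemma lim0_plus (f g : R -> R) (a b : R) :
  filterlim f (at_right 0) (locally a) -> filterlim g (at_right 0) (locally b) ->
  filterlim (fun t => f t + g t) (at_right 0) (locally (a + b)).
Proof.
  intros Hf Hg. exact (filterlim_comp_2 _ _ _ Hf Hg (filterlim_plus a b)).
Qed.

Lemma lim0_mult (f g : R -> R) (a b : R) :
  filterlim f (at_right 0) (locally a) -> filterlim g (at_right 0) (locally b) ->
  filterlim (fun t => f t * g t) (at_right 0) (locally (a * b)).
Proof.
  intros Hf Hg. exact (filterlim_comp_2 _ _ _ Hf Hg (filterlim_mult a b)).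
Qed.

Lemma has_lim0_plus (f g : R -> R) :
  has_lim0 f -> has_lim0 g -> has_lim0 (fun t => f t + g t).
Proof. intros [a Ha] [b Hb]. exists (a + b). now apply lim0_plus. Qed.

Lemma has_lim0_mult (f g : R -> R) :
  has_lim0 f -> has_lim0 g -> has_lim0 (fun t => f t * g t).
Proof. intros [a Ha] [b Hb]. exists (a * b). now apply lim0_mult. Qed.

Lemma has_lim0_const (c : R) : has_lim0 (fun _ => c).
Proof. exists c. apply filterlim_const. Qed.

Lemma lim0_id : filterlim (fun t : R => t) (at_right 0) (locally 0).
Proof.
  apply at_right_eps. intros eps heps. exists eps.
  split; [assumption|]. intros x Hx. rewrite Rabs_pos_eq; lra.
Qed.

Lemma has_lim0_id : has_lim0 (fun t => t).
Proof. exists 0. exact lim0_id. Qed.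

Lemma has_lim0_inv (f : R -> R) (l : R) :
  filterlim f (at_right 0) (locally l) -> l <> 0 -> has_lim0 (fun t => / f t).
Proof.
  intros H hl. exists (/ l).
  apply (filterlim_comp _ _ _ f Rinv _ _ _ H). now apply continuous_Rinv.
Qed.

Ltac lim0_step :=
  match goal with
  | H : has_lim0 ?f |- has_lim0 ?f => exact H
  | |- has_lim0 (fun t => @?f t + @?g t) => apply (has_lim0_plus f g)
  | |- has_lim0 (fun t => @?f t * @?g t) => apply (has_lim0_mult f g)
  | |- has_lim0 (fun t => ?c) => apply (has_lim0_const c)
  | |- has_lim0 (fun t => t) => apply has_lim0_id
  end.

Ltac lim0 := repeat (cbv beta; lim0_step); cbv beta; try assumption.

Lemma bigO_zero_quotient (n : nat) (f : R -> R) :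
  bigO_zero (S n) f -> filterlim (fun r => f r / r ^ n) (at_right 0) (locally 0).
Proof.
  intros [C [d [hd Hd]]]. apply at_right_eps. intros eps heps.
  assert (hC : 0 < Rabs C + 1) by (pose proof (Rabs_pos C); lra).
  exists (Rmin d (eps / (Rabs C + 1))). split.
  { apply Rmin_glb_lt; [lra|]. now apply Rdiv_lt_0_compat. }
  intros x Hx. pose proof (Rmin_l d (eps / (Rabs C + 1))).
  pose proof (Rmin_r d (eps / (Rabs C + 1))).
  assert (hxn : 0 < x ^ n) by (apply pow_lt; lra).
  rewrite Rminus_0_r. unfold Rdiv. rewrite Rabs_mult, (Rabs_pos_eq (/ _))
    by (left; now apply Rinv_0_lt_compat).
  assert (Hf : Rabs (f x) <= C * x ^ S n) by (apply Hd; lra).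
  apply Rle_lt_trans with (C * x).
  - apply Rmult_le_reg_r with (x ^ n); [assumption|].
    rewrite Rmult_assoc, Rinv_l, Rmult_1_r by lra. simpl in Hf. nra.
  - apply Rle_lt_trans with (Rabs C * x).
    { apply Rmult_le_compat_r; [lra|apply Rle_abs]. }
    apply Rlt_le_trans with ((Rabs C + 1) * (eps / (Rabs C + 1))).
    + pose proof (Rabs_pos C).
      apply Rle_lt_trans with (Rabs C * (eps / (Rabs C + 1))).
      * apply Rmult_le_compat_l; lra.
      * apply Rmult_lt_compat_r; [now apply Rdiv_lt_0_compat|lra].
    + right; field; lra.
Qed.

Lemma Ck_halfline_1 (f : R -> R) :
  Ck_halfline 1 f ->
  filterlim f (at_right 0) (locally (f 0)) /\
  (forall r, 0 < r -> is_derive f r (Derive f r) /\ continuous (Derive f) r) /\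
  has_lim0 (Derive f).
Proof.
  intros [H0 H]. split; [exact H0|].
  destruct (H 1%nat ltac:(lia)) as [H1 H1'].
  split; [|exact H1']. intros r hr. destruct (H1 r hr) as [D C].
  split; [apply Derive_correct, D|exact C].
Qed.

Lemma Ck_halfline_2 (f : R -> R) :
  Ck_halfline 2 f ->
  filterlim f (at_right 0) (locally (f 0)) /\
  (forall r, 0 < r -> is_derive f r (Derive f r) /\
     is_derive (Derive f) r (Derive_n f 2 r)) /\
  has_lim0 (Derive f) /\ has_lim0 (Derive_n f 2).
Proof.
  intros [H0 H]. split; [exact H0|].
  destruct (H 1%nat ltac:(lia)) as [H1 H1'].
  destruct (H 2%nat ltac:(lia)) as [H2 H2'].
  split; [|split; assumption]. intros r hr.
  destruct (H1 r hr) as [D1 _]. destruct (H2 r hr) as [D2 _].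
  split; [apply Derive_correct, D1|apply (Derive_correct (Derive f)), D2].
Qed.

Section Origin.

Variables (ell : R) (s : profile) (S1 w2 a1 : R).
Hypothesis Hsol : soliton_solution ell s S1 w2 a1.

Lemma alpha_lim0 : filterlim (alpha0 s) (at_right 0) (locally 0).
Proof.
  destruct Hsol as [_ [_ [_ [Ha _]]]].
  assert (Ha' := bigO_zero_quotient 3 _ Ha).
  set (c := a1 / 5 * (2 * a1 ^ 2 / S1 ^ 2 + 8 * w2 ^ 2 + 2 * w2 - 1 / ell ^ 2)) in *.
  pose proof lim0_id as Hid.
  assert (H : filterlim (fun r => r * ((alpha0 s r - (a1 * r + c * r ^ 3)) / r ^ 3 * (r * r)
     + (a1 + c * (r * r)))) (at_right 0) (locally (0 * (0 * (0 * 0) + (a1 + c * (0 * 0)))))).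
  { apply lim0_mult; [exact Hid|]. apply lim0_plus.
    - apply lim0_mult; [exact Ha'|]. now apply lim0_mult.
    - apply lim0_plus; [apply filterlim_const|].
      apply lim0_mult; [apply filterlim_const|]. now apply lim0_mult. }
  rewrite Rmult_0_l in H. revert H. apply lim0_ext. intros r hr. field. lra.
Qed.

Lemma omega_quotient_lim0 :
  filterlim (fun r => (omega0 s r - 1) / r ^ 2) (at_right 0) (locally w2).
Proof.
  destruct Hsol as [_ [_ [_ [_ Ho]]]].
  assert (Ho' := bigO_zero_quotient 2 _ Ho).
  assert (H := lim0_plus _ _ _ _ Ho' (filterlim_const (F := at_right 0) w2)).
  rewrite Rplus_0_l in H. revert H. apply lim0_ext. intros r hr. field. lra.
Qed.

Lemma omega_lim0 : filterlim (fun r => omega0 s r - 1) (at_right 0) (locally 0).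
Proof.
  pose proof lim0_id as Hid.
  assert (H := lim0_mult _ _ _ _ omega_quotient_lim0 (lim0_mult _ _ _ _ Hid Hid)).
  rewrite Rmult_0_l, Rmult_0_r in H. revert H. apply lim0_ext. intros r hr. field. lra.
Qed.

Lemma omega_deriv_lim0 : filterlim (Derive (omega0 s)) (at_right 0) (locally 0).
Proof.
  destruct Hsol as [[_ [_ [_ [Ho _]]]] _].
  destruct (Ck_halfline_2 _ Ho) as [_ [D [[l Hl] _]]].
  assert (H1 : filterlim (fun r => (omega0 s r - 1) / r) (at_right 0) (locally l)).
  { apply quotient_limit_at_0 with (Derive (omega0 s)); [exact omega_lim0| |exact Hl].
    intros x hx. apply is_derive_eq with (Derive (omega0 s) x + 0); [|ring].
    apply (is_derive_Rplus (omega0 s) (fun _ => - 1)); [now apply D|].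
    apply (is_derive_const (- 1)). }
  pose proof lim0_id as Hid.
  assert (H2 := lim0_mult _ _ _ _ omega_quotient_lim0 Hid).
  rewrite Rmult_0_r in H2.
  assert (H3 : filterlim (fun r => (omega0 s r - 1) / r) (at_right 0) (locally 0)).
  { revert H2. apply lim0_ext. intros r hr. field. lra. }
  rewrite (filterlim_locally_unique _ _ _ H1 H3) in Hl. exact Hl.
Qed.

Lemma alpha_quotient_has_lim0 : has_lim0 (fun r => alpha0 s r / r).
Proof.
  destruct Hsol as [[_ [_ [Ha _]]] _].
  destruct (Ck_halfline_2 _ Ha) as [_ [D [[l Hl] _]]].
  exists l. apply quotient_limit_at_0 with (Derive (alpha0 s));
    [exact alpha_lim0| |exact Hl]. intros x hx. now apply D.
Qed.

Lemma omega_deriv_quotient_has_lim0 : has_lim0 (fun r => Derive (omega0 s) r / r).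
Proof.
  destruct Hsol as [[_ [_ [_ [Ho _]]]] _].
  destruct (Ck_halfline_2 _ Ho) as [_ [D [_ [l Hl]]]].
  exists l. apply quotient_limit_at_0 with (Derive_n (omega0 s) 2);
    [exact omega_deriv_lim0| |exact Hl]. intros x hx. now apply D.
Qed.

End Origin.

(** * Pointwise bounds for small solutions *)

(* The powers of r give the regularity at the origin needed to absorb the
   poles of E1, ..., E4; those of 1 / (1 + r) give the decay at infinity that
   makes Z12 and Z21 small. *)
Record small_profile (k eta : R) (s : profile) (r : R) : Prop := SmallProfile {
  sp_al : Rabs (alpha0 s r) <= eta * (r * / (1 + r));
  sp_al' : Rabs (Derive (alpha0 s) r) <= eta * (/ (1 + r)) ^ 2;
  sp_om : Rabs (omega0 s r - 1) <= eta * (r * / (1 + r)) ^ 2;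
  sp_om' : Rabs (Derive (omega0 s) r) <= eta * (r * (/ (1 + r)) ^ 3);
  sp_mu : 1 / 2 + k * r ^ 2 <= mu0 s r <= 3 / 2 + k * r ^ 2;
  sp_mu' : r * Rabs (Derive (mu0 s) r) <= 3 * mu0 s r;
  sp_S : Rabs (S0 s r - 1) <= 1 / 2;
  sp_S' : r * Rabs (Derive (S0 s) r) <= S0 s r }.

Lemma abs_mult_le (x y a b : R) :
  Rabs x <= a -> Rabs y <= b -> Rabs (x * y) <= a * b.
Proof. intros. rewrite Rabs_mult. apply Rmult_le_compat; auto using Rabs_pos. Qed.

Lemma abs_plus_le (x y a b : R) :
  Rabs x <= a -> Rabs y <= b -> Rabs (x + y) <= a + b.
Proof. intros. eapply Rle_trans; [apply Rabs_triang|]. lra. Qed.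

Lemma abs_minus_le (x y a b : R) :
  Rabs x <= a -> Rabs y <= b -> Rabs (x - y) <= a + b.
Proof. intros. apply abs_plus_le; [|rewrite Rabs_Ropp]; assumption. Qed.

Lemma abs_opp_le (x a : R) : Rabs x <= a -> Rabs (- x) <= a.
Proof. now rewrite Rabs_Ropp. Qed.

Lemma abs_const_le (c : R) : 0 <= c -> Rabs c <= c.
Proof. intros. rewrite Rabs_pos_eq; lra. Qed.

Ltac abs_bound :=
  lazymatch goal with
  | |- Rabs (_ * _) <= _ => first [eassumption | eapply abs_mult_le; abs_bound]
  | |- Rabs (_ + _) <= _ => first [eassumption | eapply abs_plus_le; abs_bound]
  | |- Rabs (_ - _) <= _ => first [eassumption | eapply abs_minus_le; abs_bound]
  | |- Rabs (- _) <= _ => eapply abs_opp_le; abs_bound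
  | |- _ => first [eassumption | apply abs_const_le; lra]
  end.

Lemma abs_normalize (x c : R) :
  0 <= c -> Rabs x <= c -> exists y, x = c * y /\ Rabs y <= 1.
Proof.
  intros [hc|<-] H.
  2: { exists 0. rewrite Rabs_R0. pose proof (Rabs_pos x).
       destruct (Req_dec x 0) as [->|h]; [split; lra|].
       pose proof (Rabs_pos_lt x h). lra. }
  exists (x / c). split; [field; lra|].
  apply Rabs_le_between in H. apply Rabs_le. split.
  - apply Rmult_le_reg_r with c; [lra|]. unfold Rdiv.
    rewrite Rmult_assoc, Rinv_l by lra. lra.
  - apply Rmult_le_reg_r with c; [lra|]. unfold Rdiv.
    rewrite Rmult_assoc, Rinv_l by lra. lra.
Qed.

(* The ratio of mu0 to (1 + r)^2 lies between 1 / stretch k and stretch k. *)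
Definition stretch (k : R) : R := 4 + 2 / k + k.

Lemma stretch_bounds (k r m : R) :
  0 < k -> 0 < r -> 1 / 2 + k * r ^ 2 <= m <= 3 / 2 + k * r ^ 2 ->
  4 <= stretch k /\
  exists M, m = M / (/ (1 + r)) ^ 2 /\ 0 < M <= stretch k /\ 1 <= stretch k * M.
Proof.
  intros hk hr Hm.
  assert (h2k : 0 < 2 / k) by (apply Rdiv_lt_0_compat; lra).
  assert (hr2 : 0 < r ^ 2) by (apply pow_lt; lra).
  assert (E : 2 / k * k = 2) by (field; lra).
  unfold stretch. split; [lra|].
  assert (hw : 0 < (1 + r) ^ 2) by (apply pow_lt; lra).
  assert (hkr : 0 < k * r ^ 2) by (apply Rmult_lt_0_compat; lra).
  exists (m / (1 + r) ^ 2). split; [field; lra|].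
  assert (Em : m / (1 + r) ^ 2 * (1 + r) ^ 2 = m) by (field; lra).
  repeat split.
  - apply Rdiv_lt_0_compat; lra.
  - apply Rmult_le_reg_r with ((1 + r) ^ 2); [lra|]. rewrite Em.
    assert (0 < 2 / k * (1 + r) ^ 2) by (apply Rmult_lt_0_compat; lra). nra.
  - apply Rmult_le_reg_r with ((1 + r) ^ 2); [lra|].
    rewrite Rmult_assoc, Em.
    assert (A1 : (1 + r) ^ 2 <= 2 + 2 * r ^ 2) by (pose proof (pow2_ge_0 (r - 1)); nra).
    assert (A2 : 2 / k * (k * r ^ 2) = 2 * r ^ 2) by (field; lra).
    assert ((4 + 2 / k + k) * (1 / 2 + k * r ^ 2) <= (4 + 2 / k + k) * m)
      by (apply Rmult_le_compat_l; lra).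
    assert (0 < k * (k * r ^ 2)) by (apply Rmult_lt_0_compat; lra). nra.
Qed.

Lemma E_bounds (k eta : R) (s : profile) (r : R) :
  0 < k -> 0 < eta <= 1 / 4 -> 0 < r -> small_profile k eta s r ->
  / (4 * stretch k) - 80 * eta ^ 2 <= E1 s r /\
  / (8 * stretch k) - 200 * stretch k ^ 2 * eta ^ 2 <= E4 s r /\
  Rabs (E3 s r / (mu0 s r * S0 s r)) <= 60 * stretch k * eta * (/ (1 + r)) ^ 2 /\
  Rabs (E2 s r / (mu0 s r * S0 s r)) <= 60 * stretch k * eta * (/ (1 + r)) ^ 2.
Proof.
  intros hk heta hr [Hal Hal' Hom Hom' Hmu Hmu' HS HS'].
  destruct (stretch_bounds k r _ hk hr Hmu) as [hN [M [EM [hM HNM]]]].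
  assert (hmu : 0 < mu0 s r).
  { assert (0 < r ^ 2) by (apply pow_lt; lra).
    assert (0 < k * r ^ 2) by (apply Rmult_lt_0_compat; lra). lra. }
  clear Hmu. unfold E3, E1, E2, E4.
  set (N := stretch k) in *. clearbody N.
  set (w := / (1 + r)) in *.
  assert (hw : 0 < w < 1).
  { unfold w. split; [apply Rinv_0_lt_compat; lra|].
    rewrite <- Rinv_1. apply Rinv_lt_contravar; lra. }
  assert (hT : 0 < r * w < 1).
  { split; [apply Rmult_lt_0_compat; lra|].
    unfold w. apply Rmult_lt_reg_r with (1 + r); [lra|].
    rewrite Rmult_assoc, Rinv_l by lra. lra. }
  clearbody w.
  set (m := mu0 s r) in *. set (m' := Derive (mu0 s) r) in *.
  set (S := S0 s r) in *. set (S' := Derive (S0 s) r) in *.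
  set (a := alpha0 s r) in *. set (a' := Derive (alpha0 s) r) in *.
  set (o := omega0 s r) in *. set (o' := Derive (omega0 s) r) in *.
  clearbody m m' S S' a a' o o'.
  assert (hS : 1 / 2 <= S <= 3 / 2) by (apply Rabs_le_between in HS; lra).
  assert (ho : 3 / 4 <= o <= 5 / 4).
  { assert ((r * w) ^ 2 <= 1) by nra.
    assert (eta * (r * w) ^ 2 <= 1 / 4 * 1)
      by (apply Rmult_le_compat; try apply pow2_ge_0; lra).
    apply Rabs_le_between in Hom. lra. }
  (* After factoring out these weights every error term is eta^2 times a
     polynomial in quantities with fixed bounds. *)
  destruct (abs_normalize a (eta * (r * w)) ltac:(apply Rmult_le_pos; lra) Hal) as [A [EA HA]].
  assert (hw2 : 0 < w ^ 2) by (apply pow_lt; lra).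
  assert (hw3 : 0 < w ^ 3) by (apply pow_lt; lra).
  assert (hT2 : 0 < (r * w) ^ 2) by (apply pow_lt; lra).
  destruct (abs_normalize a' (eta * w ^ 2) ltac:(apply Rmult_le_pos; lra) Hal') as [B [EB HB]].
  destruct (abs_normalize (o - 1) (eta * (r * w) ^ 2) ltac:(apply Rmult_le_pos; lra) Hom) as [P [EP HP]].
  destruct (abs_normalize o' (eta * (r * w ^ 3))) as [Q [EQ HQ]];
    [repeat apply Rmult_le_pos; lra|exact Hom'|].
  set (D := r * (m' / m + S' / S)).
  assert (HD : Rabs D <= 4).
  { unfold D. rewrite Rmult_plus_distr_l. replace 4 with (3 + 1) by ring.
    apply abs_plus_le.
    - replace (r * (m' / m)) with (r * m' * / m) by (unfold Rdiv; ring).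
      rewrite 2!Rabs_mult, (Rabs_pos_eq r), (Rabs_pos_eq (/ m))
        by (try (left; apply Rinv_0_lt_compat); lra).
      apply Rmult_le_reg_r with m; [lra|]. rewrite Rmult_assoc, Rinv_l by lra. lra.
    - replace (r * (S' / S)) with (r * S' * / S) by (unfold Rdiv; ring).
      rewrite 2!Rabs_mult, (Rabs_pos_eq r), (Rabs_pos_eq (/ S))
        by (try (left; apply Rinv_0_lt_compat); lra).
      apply Rmult_le_reg_r with S; [lra|]. rewrite Rmult_assoc, Rinv_l by lra. lra. }
  assert (ED : m' / m + S' / S = D / r) by (unfold D; field; lra).
  rewrite !Rplus_assoc, ED. clearbody D. clear Hmu' HS' ED m' S'.
  assert (Eo : 1 - o ^ 2 = - (eta * (r * w) ^ 2 * P * (o + 1))).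
  { replace (1 - o ^ 2) with (- ((o - 1) * (o + 1))) by ring. rewrite EP. ring. }
  rewrite Eo. subst a a' o' m. clear Hal Hal' Hom Hom' EP Eo.
  set (v := / (r * w) ^ 2).
  assert (hv : 1 <= v).
  { unfold v. rewrite <- Rinv_1. apply Rinv_le_contravar; nra. }
  assert (EN : / N <= M).
  { apply Rmult_le_reg_l with N; [lra|]. rewrite Rinv_r; lra. }
  assert (EM : / M <= N).
  { apply Rmult_le_reg_l with M; [lra|]. rewrite Rinv_r; lra. }
  assert (hM' : 0 < / M) by (apply Rinv_0_lt_compat; lra).
  assert (hN' : 0 < / N) by (apply Rinv_0_lt_compat; lra).
  assert (Ho : Rabs o <= 5 / 4) by (apply Rabs_le; lra).
  assert (Ho2 : Rabs (o ^ 2) <= 25 / 16) by (apply Rabs_le; nra).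
  assert (Ho1 : Rabs (o + 1) <= 9 / 4) by (apply Rabs_le; lra).
  assert (Hoi : Rabs (/ o) <= 4 / 3).
  { rewrite Rabs_pos_eq by (left; apply Rinv_0_lt_compat; lra).
    replace (4 / 3) with (/ (3 / 4)) by field. apply Rinv_le_contravar; lra. }
  assert (HMi : Rabs (/ M) <= N) by (rewrite Rabs_pos_eq; lra).
  assert (HMa : Rabs M <= N) by (rewrite Rabs_pos_eq; lra).
  assert (Hw : Rabs w <= 1) by (apply Rabs_le; lra).
  assert (HT : Rabs (r * w) <= 1) by (apply Rabs_le; lra).
  assert (HS2 : Rabs (S ^ 2) <= 9 / 4) by (apply Rabs_le; nra).
  assert (hS2 : 1 / 4 <= S ^ 2) by nra.
  assert (Hw2 : Rabs (w ^ 2) <= 1) by (apply Rabs_le; nra).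
  assert (Hw3 : Rabs (w ^ 3) <= 1) by (simpl; apply Rabs_le; nra).
  assert (HT2 : Rabs ((r * w) ^ 2) <= 1) by (apply Rabs_le; nra).
  assert (heta2 : 0 <= eta ^ 2) by apply pow2_ge_0.
  assert (hMS : / N * / 4 <= M * S ^ 2) by (apply Rmult_le_compat; lra).
  assert (hpos : 0 < / N * / 4) by lra.
  split; [|split].
  - set (R1 := 8 * w ^ 3 * A * B * o ^ 2 - 4 * w ^ 2 * A * A * o ^ 2 * (1 + D)).
    assert (HR1 : Rabs R1 <= 80).
    { unfold R1. eapply Rle_trans; [abs_bound|lra]. }
    match goal with |- _ <= ?X =>
      replace X with ((eta * (r * w) * A) ^ 2 + M * S ^ 2 * (1 + o ^ 2) * v
        + 2 * (M / w ^ 2 * S * (eta * (r * w ^ 3) * Q) / o) ^ 2 + eta ^ 2 * R1)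
        by (unfold R1, v; field; repeat split; lra) end.
    pose proof (pow2_ge_0 (eta * (r * w) * A)).
    pose proof (pow2_ge_0 (M / w ^ 2 * S * (eta * (r * w ^ 3) * Q) / o)).
    apply Rabs_le_between in HR1.
    assert (- 80 * eta ^ 2 <= eta ^ 2 * R1) by nra.
    assert (/ N * / 4 * 1 <= M * S ^ 2 * (1 + o ^ 2)) by (apply Rmult_le_compat; nra).
    assert (/ N * / 4 * 1 * 1 <= M * S ^ 2 * (1 + o ^ 2) * v)
      by (apply Rmult_le_compat; lra).
    rewrite Rinv_mult. lra.
  - set (R4 := - (4 * M * M * S ^ 2 * w ^ 2 * Q * Q * D)
               - 4 * M * S ^ 2 * Q * w * (- (2 * o * w ^ 2 * P * (o + 1)) + M * w * Q)).
    assert (HR4 : Rabs R4 <= 200 * N ^ 2).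
    { unfold R4. eapply Rle_trans; [abs_bound|nra]. }
    match goal with |- _ <= ?X =>
      replace X with (3 * (eta * (r * w) * A) ^ 2 + M * S ^ 2 * (3 * o ^ 2 - 1) * v
        + eta ^ 2 * R4) by (unfold R4, v; field; repeat split; lra) end.
    pose proof (pow2_ge_0 (eta * (r * w) * A)).
    apply Rabs_le_between in HR4.
    assert (- (200 * N ^ 2) * eta ^ 2 <= eta ^ 2 * R4) by nra.
    assert (/ N * / 4 * / 2 <= M * S ^ 2 * (3 * o ^ 2 - 1)) by (apply Rmult_le_compat; nra).
    assert (/ N * / 4 * / 2 * 1 <= M * S ^ 2 * (3 * o ^ 2 - 1) * v)
      by (apply Rmult_le_compat; lra).
    rewrite Rinv_mult. lra.
  - set (R3 := 4 * w ^ 3 * A * P * o ^ 2 * (o + 1) * / M + 4 * o * w ^ 3 * Q * B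
      - 4 * A * o * Q * (w ^ 2 * (1 + D) + (r * w) ^ 2 * / o * / o * / 2)).
    assert (HR3 : Rabs R3 <= 23 * N).
    { unfold R3. eapply Rle_trans; [abs_bound|lra]. }
    assert (Hc : forall x, Rabs x <= 60 * N * eta ->
      Rabs (w ^ 2 * x) <= 60 * N * eta * w ^ 2).
    { intros x Hx. rewrite Rabs_mult, (Rabs_pos_eq (w ^ 2)) by lra. nra. }
    split.
    + match goal with |- Rabs ?X <= _ =>
        replace X with (w ^ 2 * (eta * (eta * R3)))
          by (unfold R3; field; repeat split; lra) end.
      apply Hc. rewrite 2!Rabs_mult, (Rabs_pos_eq eta) by lra.
      assert (eta * Rabs R3 <= 1 / 4 * (23 * N))
        by (apply Rmult_le_compat; try apply Rabs_pos; lra). nra.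
    + match goal with |- Rabs ?X <= _ =>
        replace X with (w ^ 2 * (eta * (2 * B + eta * R3)))
          by (unfold R3; field; repeat split; lra) end.
      apply Hc. rewrite Rabs_mult, (Rabs_pos_eq eta) by lra.
      assert (Rabs (2 * B + eta * R3) <= 2 * 1 + 1 / 4 * (23 * N)).
      { apply abs_plus_le; apply abs_mult_le; try assumption; apply Rabs_le; lra. }
      nra.
Qed.

(** * Positivity and stability for small solutions *)

Lemma bounded_by_tail (f df : R -> R) (c : R) :
  filterlim f (at_right 0) (locally 0) ->
  (forall r, 0 < r -> is_derive f r (df r)) ->
  (forall r, 0 < r -> Rabs (df r) <= c * (/ (1 + r)) ^ 2) ->
  forall r, 0 < r -> Rabs (f r) <= c.
Proof.
  intros H0 Hd Hb r hr.
  assert (hc : 0 <= c).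
  { pose proof (Hb 1 Rlt_0_1). pose proof (Rabs_pos (df 1)).
    replace (/ (1 + 1)) with (1 / 2) in * by field. lra. }
  apply le_epsilon. intros eps heps.
  destruct (proj1 (at_right_eps f 0 0) H0 eps heps) as [d [hd Hdd]].
  set (y := Rmin (d / 2) (r / 2)).
  assert (hy : 0 < y /\ y <= d / 2 /\ y <= r / 2).
  { unfold y. repeat split; [apply Rmin_glb_lt; lra|apply Rmin_l|apply Rmin_r]. }
  pose proof (Hdd y ltac:(lra)) as Hy. rewrite Rminus_0_r in Hy. apply Rabs_def2 in Hy.
  assert (Hw : forall t, 0 < t -> is_derive (fun t => - (c * / (1 + t))) t (c * (/ (1 + t)) ^ 2)).
  { intros t ht. auto_derive; [lra|field; lra]. }
  assert (hwy : 0 <= c * / (1 + y) <= c).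
  { assert (0 < / (1 + y) <= 1).
    { split; [apply Rinv_0_lt_compat; lra|]. rewrite <- Rinv_1.
      apply Rinv_le_contravar; lra. }
    split; [apply Rmult_le_pos; lra|]. nra. }
  assert (hwr : 0 <= c * / (1 + r)).
  { apply Rmult_le_pos; [lra|]. left; apply Rinv_0_lt_compat; lra. }
  assert (A1 : - (c * / (1 + y)) + f y <= - (c * / (1 + r)) + f r).
  { apply (derive_nonneg_le (fun t => - (c * / (1 + t)) + f t)
      (fun t => c * (/ (1 + t)) ^ 2 + df t)); [lra| |]; intros t Ht.
    - apply is_derive_Rplus; [apply Hw|apply Hd]; lra.
    - pose proof (Hb t ltac:(lra)) as h. apply Rabs_le_between in h. lra. }
  assert (A2 : - (c * / (1 + y)) + - f y <= - (c * / (1 + r)) + - f r).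
  { apply (derive_nonneg_le (fun t => - (c * / (1 + t)) + - f t)
      (fun t => c * (/ (1 + t)) ^ 2 + - df t)); [lra| |]; intros t Ht.
    - apply is_derive_Rplus; [apply Hw|apply is_derive_Ropp, Hd]; lra.
    - pose proof (Hb t ltac:(lra)) as h. apply Rabs_le_between in h. lra. }
  apply Rabs_le. lra.
Qed.

Section Soliton.

Variables (ell k eta S1 w2 a1 : R) (s : profile).
Hypothesis hk : 0 < k.
Hypothesis heta : 0 < eta <= / (200 * stretch k ^ 2).
Hypothesis Hsol : soliton_solution ell s S1 w2 a1.
Hypothesis Hpos : positive_profile s.
Hypothesis Hsmall : forall r, 0 < r -> small_profile k eta s r.

Local Notation mu := (mu0 s).
Local Notation S := (S0 s).
Local Notation al := (alpha0 s).
Local Notation om := (omega0 s).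

Lemma stretch_ge : 4 <= stretch k.
Proof.
  unfold stretch. assert (0 < 2 / k) by (apply Rdiv_lt_0_compat; lra). lra.
Qed.

Lemma eta_small : 0 < eta <= 1 / 4.
Proof.
  pose proof stretch_ge. split; [lra|]. eapply Rle_trans; [apply heta|].
  replace (1 / 4) with (/ 4) by field. apply Rinv_le_contravar; nra.
Qed.

Lemma background_continuous (r : R) : 0 < r ->
  continuous mu r /\ continuous S r /\ continuous al r /\ continuous om r /\
  continuous (Derive mu) r /\ continuous (Derive S) r /\
  continuous (Derive al) r /\ continuous (Derive om) r.
Proof.
  intros hr. destruct Hsol as [[Hm [HS [Ha [Ho _]]]] _].
  destruct (Ck_halfline_1 _ Hm) as [_ [Dm _]]. destruct (Ck_halfline_1 _ HS) as [_ [DS _]].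
  destruct (Ck_halfline_2 _ Ha) as [_ [Da _]]. destruct (Ck_halfline_2 _ Ho) as [_ [Do _]].
  destruct (Dm r hr) as [m1 m2]. destruct (DS r hr) as [s1 s2].
  destruct (Da r hr) as [a1' a2]. destruct (Do r hr) as [o1 o2].
  repeat match goal with |- _ /\ _ => split end;
    first [assumption | eapply is_derive_cont; eassumption].
Qed.

Lemma background_nonzero (r : R) : 0 < r ->
  mu r <> 0 /\ S r <> 0 /\ om r <> 0 /\ mu r * S r <> 0 /\ 0 < / (mu r * S r).
Proof.
  intros hr. destruct (Hpos r ltac:(lra)) as [h1 [h2 h3]].
  assert (0 < mu r * S r) by now apply Rmult_lt_0_compat.
  repeat split; try lra. now apply Rinv_0_lt_compat.
Qed.

Lemma E_continuous (r : R) : 0 < r ->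
  continuous (E1 s) r /\ continuous (E2 s) r /\ continuous (E3 s) r /\ continuous (E4 s) r.
Proof.
  intros hr.
  destruct (background_continuous r hr) as [c1 [c2 [c3 [c4 [c5 [c6 [c7 c8]]]]]]].
  destruct (background_nonzero r hr) as [n1 [n2 [n3 _]]].
  assert (ci : continuous (fun t : R => t) r) by apply continuous_id.
  assert (E2c : continuous (E2 s) r).
  { unfold E2. cont; try (apply pow_nonzero); try apply Rmult_integral_contrapositive_currified;
      try apply pow_nonzero; try assumption; try lra. }
  repeat split.
  - unfold E1. cont; try (apply pow_nonzero); try assumption; lra.
  - exact E2c.
  - unfold E3. apply (cont_Rminus (E2 s) (fun t => 2 * mu t * S t * Derive al t)); [exact E2c|].
    cont.
  - unfold E4. cont; try (apply pow_nonzero); try assumption; lra.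
Qed.

Lemma integrand_continuous (E : R -> R) (r : R) : 0 < r -> continuous E r ->
  continuous (fun x => E x / (mu x * S x)) r.
Proof.
  intros hr HE.
  destruct (background_continuous r hr) as [c1 [c2 _]].
  destruct (background_nonzero r hr) as [n1 [n2 [n3 [n4 _]]]].
  cont.
Qed.

Lemma integrands_has_lim0 :
  has_lim0 (fun x => E3 s x / (mu x * S x)) /\
  has_lim0 (fun x => E2 s x / (mu x * S x)) /\
  has_lim0 (fun x => / (mu x * S x)).
Proof.
  pose proof (alpha_quotient_has_lim0 _ _ _ _ _ Hsol) as La.
  pose proof (omega_deriv_quotient_has_lim0 _ _ _ _ _ Hsol) as Lo'.
  assert (Lo : has_lim0 (fun r => (om r - 1) / r ^ 2))
    by (exists w2; apply (omega_quotient_lim0 _ _ _ _ _ Hsol)).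
  destruct Hsol as [[Hm [HS [Ha [Ho _]]]] _].
  destruct (Ck_halfline_1 _ Hm) as [Lm [_ Lm']]. destruct (Ck_halfline_1 _ HS) as [LS [_ LS']].
  destruct (Ck_halfline_2 _ Ha) as [_ [_ [La' _]]]. destruct (Ck_halfline_2 _ Ho) as [Lo0 _].
  destruct (Hpos 0 ltac:(lra)) as [h1 [h2 h3]].
  pose proof (has_lim0_inv _ _ Lm ltac:(lra)) as Lmi.
  pose proof (has_lim0_inv _ _ LS ltac:(lra)) as LSi.
  pose proof (has_lim0_inv _ _ Lo0 ltac:(lra)) as Loi.
  assert (Lo1 : has_lim0 om) by (now exists (om 0)).
  assert (L3 : has_lim0 (fun x => E3 s x / (mu x * S x))).
  { apply has_lim0_ext with (fun r =>
      4 * (al r / r) * om r * om r * ((om r - 1) / r ^ 2) * (om r + 1) * / mu r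
      + 4 * om r * (Derive om r / r) * Derive al r
      + (- 4) * (al r / r) * om r * (Derive om r / r)
        * (1 + r * r * / om r * / om r * / 2
           + r * Derive mu r * / mu r + r * Derive S r * / S r)).
    - intros r hr. destruct (background_nonzero r hr) as [n1 [n2 [n3 _]]].
      unfold E3, E2. field. repeat split; lra.
    - lim0. }
  split; [exact L3|]. split.
  - apply has_lim0_ext with (fun r => E3 s r / (mu r * S r) + 2 * Derive al r).
    + intros r hr. destruct (background_nonzero r hr) as [n1 [n2 [n3 _]]].
      unfold E3. field. now split.
    + lim0.
  - apply has_lim0_ext with (fun r => / mu r * / S r).
    + intros r hr. destruct (background_nonzero r hr) as [n1 [n2 [n3 _]]]. field. now split.
    + lim0.
Qed.

Lemma Z_rstar_derive (r : R) : 0 < r ->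
  is_derive (Z12 s) r (E2 s r / (mu r * S r)) /\
  is_derive (Z21 s) r (E3 s r / (mu r * S r)) /\
  is_derive (rstar s) r (/ (mu r * S r)).
Proof.
  intros hr. destruct integrands_has_lim0 as [[l3 H3] [[l2 H2] [l1 H1]]].
  split; [|split].
  - apply (is_derive_RInt_right_limit (fun x => E2 s x / (mu x * S x)) 0 r l2 H2); [|exact hr].
    intros y hy. apply integrand_continuous; [exact hy|]. exact (proj1 (proj2 (E_continuous y hy))).
  - apply (is_derive_RInt_right_limit (fun x => E3 s x / (mu x * S x)) 0 r l3 H3); [|exact hr].
    intros y hy. apply integrand_continuous; [exact hy|]. exact (proj1 (proj2 (proj2 (E_continuous y hy)))).
  - apply (is_derive_RInt_right_limit (fun x => / (mu x * S x)) 0 r l1 H1); [|exact hr].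
    intros y hy. destruct (background_continuous y hy) as [c1 [c2 _]].
    destruct (background_nonzero y hy) as [_ [_ [_ [n _]]]].
    apply (continuous_comp (fun x => mu x * S x) Rinv); [cont|now apply continuous_Rinv].
Qed.

Lemma Z_lim0 :
  filterlim (Z12 s) (at_right 0) (locally 0) /\
  filterlim (Z21 s) (at_right 0) (locally 0) /\
  filterlim (rstar s) (at_right 0) (locally 0).
Proof.
  destruct integrands_has_lim0 as [[l3 H3] [[l2 H2] [l1 H1]]].
  split; [|split].
  - apply (RInt_right_limit_at_0 (fun x => E2 s x / (mu x * S x)) 0 l2 H2).
    intros y hy. apply integrand_continuous; [exact hy|]. exact (proj1 (proj2 (E_continuous y hy))).
  - apply (RInt_right_limit_at_0 (fun x => E3 s x / (mu x * S x)) 0 l3 H3).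
    intros y hy. apply integrand_continuous; [exact hy|]. exact (proj1 (proj2 (proj2 (E_continuous y hy)))).
  - apply (RInt_right_limit_at_0 (fun x => / (mu x * S x)) 0 l1 H1).
    intros y hy. destruct (background_continuous y hy) as [c1 [c2 _]].
    destruct (background_nonzero y hy) as [_ [_ [_ [n _]]]].
    apply (continuous_comp (fun x => mu x * S x) Rinv); [cont|now apply continuous_Rinv].
Qed.

Lemma Z_bound (r : R) : 0 < r ->
  Rabs (Z12 s r) <= 60 * stretch k * eta /\ Rabs (Z21 s r) <= 60 * stretch k * eta.
Proof.
  intros hr. destruct Z_lim0 as [L1 [L2 _]].
  split.
  - apply (bounded_by_tail (Z12 s) (fun t => E2 s t / (mu t * S t)) _ L1);
      [| |exact hr]; intros t ht; [now apply Z_rstar_derive|].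
    apply (E_bounds k eta s t hk eta_small ht (Hsmall t ht)).
  - apply (bounded_by_tail (Z21 s) (fun t => E3 s t / (mu t * S t)) _ L2);
      [| |exact hr]; intros t ht; [now apply Z_rstar_derive|].
    apply (E_bounds k eta s t hk eta_small ht (Hsmall t ht)).
Qed.

Lemma Z_diff (r : R) : 0 < r -> Z12 s r - Z21 s r = 2 * al r.
Proof.
  intros hr. destruct Z_lim0 as [L1 [L2 _]].
  pose proof (alpha_lim0 _ _ _ _ _ Hsol) as La.
  assert (H : Z12 s r + (- 1) * Z21 s r + (- 2) * al r = 0); [|lra].
  apply (constant_of_derive_0 (fun r => Z12 s r + (- 1) * Z21 s r + (- 2) * al r));
    [| |exact hr].
  - pose proof (lim0_plus _ _ _ _ (lim0_plus _ _ _ _ L1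
      (lim0_mult _ _ _ _ (filterlim_const (- 1)) L2))
      (lim0_mult _ _ _ _ (filterlim_const (- 2)) La)) as H.
    replace (0 + - 1 * 0 + - 2 * 0) with 0 in H by ring. exact H.
  - intros x hx. destruct (Z_rstar_derive x hx) as [D1 [D2 _]].
    destruct Hsol as [[_ [_ [Ha _]]] _].
    destruct (Ck_halfline_2 _ Ha) as [_ [Da _]]. destruct (Da x hx) as [D3 _].
    destruct (background_nonzero x hx) as [n1 [n2 _]].
    eapply is_derive_eq.
    + apply is_derive_Rplus; [apply is_derive_Rplus; [exact D1|]|];
        apply is_derive_scal; [exact D2|exact D3].
    + unfold E3. field. now split.
Qed.

Theorem K_positive (r : R) : 0 < r -> 0 < K1 s r /\ 0 < K2 s r.
Proof.
  intros hr. destruct (Z_bound r hr) as [Z1 Z2].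
  destruct (E_bounds k eta s r hk eta_small hr (Hsmall r hr)) as [H1 [H4 _]].
  pose proof stretch_ge as hN. pose proof eta_small as he4. unfold K1, K2. set (N := stretch k) in *. clearbody N.
  assert (hN2 : 16 <= N ^ 2) by nra.
  assert (He : 200 * N ^ 2 * eta <= 1).
  { apply Rmult_le_reg_r with (/ (200 * N ^ 2)); [apply Rinv_0_lt_compat; lra|].
    replace (200 * N ^ 2 * eta * / (200 * N ^ 2)) with eta by (field; lra). lra. }
  assert (HZ : forall z, Rabs z <= 60 * N * eta -> z ^ 2 <= 3600 * N ^ 2 * eta ^ 2).
  { intros z Hz. rewrite <- pow2_abs. pose proof (Rabs_pos z).
    replace (3600 * N ^ 2 * eta ^ 2) with ((60 * N * eta) ^ 2) by ring.
    apply pow_incr. lra. }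
  pose proof (HZ _ Z1). pose proof (HZ _ Z2).
  assert (hNe : N ^ 2 * eta ^ 2 <= / 200 * eta) by nra.
  assert (hNe2 : N * eta <= / 200 * / 4) by nra.
  assert (hi : 0 < / N) by (apply Rinv_0_lt_compat; lra).
  assert (hei : eta <= / 800 * / N).
  { apply Rmult_le_reg_l with N; [lra|].
    replace (N * (/ 800 * / N)) with (/ 800) by (field; lra). lra. }
  assert (he2 : eta ^ 2 <= eta * / 4) by nra.
  rewrite Rinv_mult in H1, H4.
  split; lra.
Qed.

Lemma rstar_increasing (r t : R) : 0 < r -> r < t -> rstar s r < rstar s t.
Proof.
  intros hr hrt. apply derive_pos_lt with (fun x => / (mu x * S x)); [exact hrt| |];
    intros x Hx; [apply Z_rstar_derive|apply background_nonzero]; lra.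
Qed.

Lemma rstar_bound (r : R) : 0 < r -> Rabs (rstar s r) <= 2 * stretch k.
Proof.
  intros hr. destruct Z_lim0 as [_ [_ L]].
  apply (bounded_by_tail (rstar s) (fun x => / (mu x * S x)) _ L); [| |exact hr].
  - intros t ht. now apply Z_rstar_derive.
  - intros t ht. destruct (Hsmall t ht) as [_ _ _ _ Hmu _ HS _].
    destruct (stretch_bounds k t _ hk ht Hmu) as [hN [M [EM [hM HNM]]]].
    destruct (background_nonzero t ht) as [n1 [n2 [n3 [_ np]]]].
    rewrite Rabs_pos_eq by lra. rewrite EM in *.
    assert (hS : 1 / 2 <= S t) by (apply Rabs_le_between in HS; lra).
    set (w := / (1 + t)) in *.
    assert (hw : 0 < w) by (apply Rinv_0_lt_compat; lra). clearbody w.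
    replace (/ (M / w ^ 2 * S t)) with (/ M * / S t * w ^ 2) by (field; lra).
    apply Rmult_le_compat_r; [apply pow2_ge_0|]. rewrite (Rmult_comm 2).
    apply Rmult_le_compat; try (left; apply Rinv_0_lt_compat; lra).
    + apply Rmult_le_reg_l with M; [lra|]. rewrite Rinv_r; lra.
    + replace 2 with (/ (1 / 2)) by field. apply Rinv_le_contravar; lra.
Qed.

Lemma rstar_range : exists X, 0 < X /\ is_lim (rstar s) p_infty X /\
  forall x, 0 < x < X -> exists r, 0 < r /\ rstar s r = x.
Proof.
  destruct (completeness (fun y => exists r, 0 < r /\ y = rstar s r)) as [X [Hub Hlub]].
  { exists (2 * stretch k). intros y [r [hr ->]].
    pose proof (rstar_bound r hr). pose proof (Rle_abs (rstar s r)). lra. }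
  { exists (rstar s 1), 1. split; [lra|reflexivity]. }
  assert (Hlt : forall r, 0 < r -> rstar s r < X).
  { intros r hr. apply Rlt_le_trans with (rstar s (r + 1)).
    - apply rstar_increasing; lra.
    - apply Hub. exists (r + 1). split; [lra|reflexivity]. }
  assert (Hap : forall y, y < X -> exists r, 0 < r /\ y < rstar s r).
  { intros y hy. destruct (classic (exists r, 0 < r /\ y < rstar s r)) as [h|h]; [exact h|].
    exfalso. assert (X <= y); [|lra]. apply Hlub. intros z [r [hr ->]].
    apply Rnot_lt_le. intros h'. apply h. now exists r. }
  destruct Z_lim0 as [_ [_ L]].
  assert (Hsm : forall y, 0 < y -> exists r, 0 < r /\ rstar s r < y).
  { intros y hy. destruct (proj1 (at_right_eps _ _ _) L y hy) as [d [hd Hd]].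
    exists (d / 2). split; [lra|]. pose proof (Hd (d / 2) ltac:(lra)) as h.
    apply Rabs_def2 in h. lra. }
  assert (Hp : forall r, 0 < r -> 0 < rstar s r).
  { intros r hr. apply Rle_lt_trans with (rstar s (r / 2)).
    - apply Rnot_lt_le. intros hn.
      destruct (proj1 (at_right_eps _ _ _) L (- rstar s (r / 2))) as [d [hd Hd]]; [lra|].
      set (y := Rmin (d / 2) (r / 4)).
      assert (hy : 0 < y /\ y <= d / 2 /\ y <= r / 4).
      { unfold y. repeat split; [apply Rmin_glb_lt; lra|apply Rmin_l|apply Rmin_r]. }
      pose proof (Hd y ltac:(lra)) as h. apply Rabs_def2 in h.
      pose proof (rstar_increasing y (r / 2) ltac:(lra) ltac:(lra)). lra.
    - apply rstar_increasing; lra. }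
  exists X. split; [|split].
  - apply Rlt_trans with (rstar s 1); [apply Hp|apply Hlt]; lra.
  - apply filterlim_locally. intros eps.
    destruct (Hap (X - eps)) as [r [hr Hr]]; [pose proof (cond_pos eps); lra|].
    exists r. intros t ht. change (Rabs (rstar s t - X) < eps).
    pose proof (rstar_increasing r t hr ht). pose proof (Hlt t ltac:(lra)).
    apply Rabs_def1; lra.
  - intros x Hx. destruct (Hsm x) as [r1 [hr1 H1]]; [lra|].
    destruct (Hap x) as [r2 [hr2 H2]]; [lra|].
    assert (hrr : r1 < r2).
    { apply Rnot_le_lt. intros h. destruct (Req_dec r1 r2) as [->|hne]; [lra|].
      pose proof (rstar_increasing r2 r1 hr2 ltac:(lra)). lra. }
    destruct (IVT_interv (fun t => rstar s t - x) r1 r2) as [z [Hz Ez]]; try lra.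
    + intros t Ht. apply continuity_pt_minus.
      * apply (is_derive_continuity_pt _ _ (/ (mu t * S t))). apply Z_rstar_derive; lra.
      * apply continuity_pt_const. now intros p q.
    + exists z. split; lra.
Qed.

Theorem soliton_linearly_stable : linearly_stable s.
Proof.
  destruct rstar_range as [X [hX [Hlim Hran]]].
  assert (Hrad : forall x, 0 < x < X -> 0 < radius s x /\ rstar s (radius s x) = x).
  { intros x Hx. exact (epsilon_spec (inhabits 0) (fun r => 0 < r /\ rstar s r = x) (Hran x Hx)). }
  assert (Drad : forall x, 0 < x < X ->
    is_derive (radius s) x (mu (radius s x) * S (radius s x))).
  { intros x Hx. destruct (Hrad x Hx) as [hr _].
    destruct (background_nonzero _ hr) as [_ [_ [_ [n _]]]].
    rewrite <- (Rinv_inv (mu (radius s x) * S (radius s x))).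
    apply (is_derive_inverse (rstar s) (fun r => / (mu r * S r)) (radius s) X);
      try assumption; intros r h; [now apply Z_rstar_derive|now apply background_nonzero]. }
  assert (Crad : forall (f : R -> R) x, 0 < x < X -> continuous f (radius s x) ->
    continuous (fun y => f (radius s y)) x).
  { intros f x Hx Hf. apply (continuous_comp (radius s) f); [|exact Hf].
    apply (is_derive_cont _ _ _ (Drad x Hx)). }
  assert (Dcomp : forall (f : R -> R) (e x : R), 0 < x < X ->
    is_derive f (radius s x) (e / (mu (radius s x) * S (radius s x))) ->
    is_derive (fun y => f (radius s y)) x e).
  { intros f e x Hx Hf. destruct (Hrad x Hx) as [hr _].
    destruct (background_nonzero _ hr) as [n1 [n2 [_ [n _]]]].
    eapply is_derive_eq.
    - exact (is_derive_comp f (radius s) x _ _ Hf (Drad x Hx)).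
    - change (mu (radius s x) * S (radius s x) * (e / (mu (radius s x) * S (radius s x))) = e).
      field. now split. }
  set (rad := radius s).
  assert (H12 : forall x, 0 < x < X -> is_derive (fun y => Z12 s (rad y)) x (E2 s (rad x))).
  { intros x Hx. apply Dcomp; [exact Hx|]. apply Z_rstar_derive. now apply Hrad. }
  assert (H21 : forall x, 0 < x < X -> is_derive (fun y => Z21 s (rad y)) x (E3 s (rad x))).
  { intros x Hx. apply Dcomp; [exact Hx|]. apply Z_rstar_derive. now apply Hrad. }
  assert (Ha : forall x, 0 < x < X -> 2 * al (rad x) = Z12 s (rad x) - Z21 s (rad x)).
  { intros x Hx. symmetry. apply Z_diff. now apply Hrad. }
  assert (Hac : forall x, 0 < x < X -> continuous (fun y => al (rad y)) x).
  { intros x Hx. apply Crad; [exact Hx|].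
    destruct (Hrad x Hx) as [hr _].
    destruct (background_continuous _ hr) as [_ [_ [c _]]]. exact c. }
  assert (HE : forall x, 0 < x < X ->
    continuous (fun y => E1 s (rad y)) x /\ continuous (fun y => E2 s (rad y)) x /\
    continuous (fun y => E3 s (rad y)) x /\ continuous (fun y => E4 s (rad y)) x).
  { intros x Hx. destruct (E_continuous (rad x)) as [c1 [c2 [c3 c4]]]; [now apply Hrad|].
    repeat split; now apply Crad. }
  assert (Hz : forall x, 0 < x < X -> Rabs (Z12 s (rad x)) <= 60 * stretch k * eta /\
    Rabs (Z21 s (rad x)) <= 60 * stretch k * eta).
  { intros x Hx. apply Z_bound. now apply Hrad. }
  pose proof (pert_op_symmetric X (fun y => al (rad y)) (fun y => E1 s (rad y))
    (fun y => E2 s (rad y)) (fun y => E3 s (rad y)) (fun y => E4 s (rad y))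
    (fun y => Z12 s (rad y)) (fun y => Z21 s (rad y)) hX H12 H21 Ha Hac
    (fun x Hx => proj1 (HE x Hx)) (fun x Hx => proj1 (proj2 (HE x Hx)))
    (fun x Hx => proj1 (proj2 (proj2 (HE x Hx))))
    (fun x Hx => proj2 (proj2 (proj2 (HE x Hx)))) _ Hz) as Hsym.
  pose proof (fun v => pert_op_positive X (fun y => al (rad y)) (fun y => E1 s (rad y))
    (fun y => E2 s (rad y)) (fun y => E3 s (rad y)) (fun y => E4 s (rad y))
    (fun y => Z12 s (rad y)) (fun y => Z21 s (rad y)) hX H12 H21 Ha Hac
    (fun x Hx => proj1 (HE x Hx)) (fun x Hx => proj1 (proj2 (HE x Hx)))
    (fun x Hx => proj1 (proj2 (proj2 (HE x Hx))))
    (fun x Hx => proj2 (proj2 (proj2 (HE x Hx)))) _ Hz v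
    (fun x Hx => K_positive (rad x) (proj1 (Hrad x Hx)))) as Hp.
  exists X. split; [exact Hlim|]. split; [exact Hsym|exact Hp].
Qed.

End Soliton.

(** * The energy estimate on r >= 1 *)

Lemma energy_rate (r a o q p S m i c y : R) :
  1 <= r -> 0 < c -> 0 <= y <= 1 / 4 -> 0 <= i <= 2 -> i <= c * / r ^ 2 ->
  Rabs a <= y -> Rabs (o - 1) <= y -> Rabs q <= y -> Rabs p <= y ->
  Rabs (S - 1) <= y -> Rabs m <= y ->
  2 * a * (S * q / r ^ 2) + 2 * (o - 1) * (p * i / S)
  + 2 * q * (2 * a * o ^ 2 * i / S)
  + 2 * p * (- (S * o * (1 - o ^ 2) / r ^ 2) - a ^ 2 * o * i / S)
  + 2 * (S - 1) * (2 * p ^ 2 * i ^ 2 / (r * S) + 2 * a ^ 2 * o ^ 2 * i ^ 2 / (r * S))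
  + 2 * m * (q ^ 2 / (2 * r ^ 2) + a ^ 2 * o ^ 2 * i / S ^ 2 + p ^ 2 * i / S ^ 2
             + (1 - o ^ 2) ^ 2 / (2 * r ^ 2))
  <= 24 * (1 + c) * / r ^ 2 * y ^ 2.
Proof.
  intros hr hc hy hi hic Ha Ho Hq Hp HS Hm.
  assert (hS : 3 / 4 <= S <= 5 / 4) by (apply Rabs_le_between in HS; lra).
  assert (ho : 3 / 4 <= o <= 5 / 4) by (apply Rabs_le_between in Ho; lra).
  set (t := / r ^ 2) in *.
  assert (hr2 : 0 < r ^ 2) by (apply pow_lt; lra).
  assert (ht : 0 < t) by now apply Rinv_0_lt_compat.
  assert (Hct : 0 <= c * t) by (apply Rmult_le_pos; lra).
  destruct (abs_normalize a y (proj1 hy) Ha) as [A [EA HA]].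
  destruct (abs_normalize (o - 1) y (proj1 hy) Ho) as [O [EO HO]].
  destruct (abs_normalize q y (proj1 hy) Hq) as [Q [EQ HQ]].
  destruct (abs_normalize p y (proj1 hy) Hp) as [P [EP HP]].
  destruct (abs_normalize i (c * t)) as [J [EJ HJ]];
    [exact Hct|rewrite Rabs_pos_eq; lra|].
  assert (HSs : Rabs S <= 5 / 4) by (apply Rabs_le; lra).
  assert (Hos : Rabs o <= 5 / 4) by (apply Rabs_le; lra).
  assert (Ho2 : Rabs (o ^ 2) <= 25 / 16) by (apply Rabs_le; nra).
  assert (Ho1 : Rabs (o + 1) <= 9 / 4) by (apply Rabs_le; lra).
  assert (Hy : Rabs y <= 1 / 4) by (apply Rabs_le; lra).
  assert (HSi : Rabs (/ S) <= 4 / 3).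
  { rewrite Rabs_pos_eq by (left; apply Rinv_0_lt_compat; lra).
    replace (4 / 3) with (/ (3 / 4)) by field. apply Rinv_le_contravar; lra. }
  assert (Hri : Rabs (/ r) <= 1).
  { rewrite Rabs_pos_eq by (left; apply Rinv_0_lt_compat; lra).
    rewrite <- Rinv_1. apply Rinv_le_contravar; lra. }
  assert (Hi : Rabs i <= 2) by (apply Rabs_le; lra).
  assert (Hm' : Rabs m <= 1 / 4) by lra.
  assert (HS' : Rabs (S - 1) <= 1 / 4) by lra.
  assert (Hc : Rabs c <= c) by (rewrite Rabs_pos_eq; lra).
  set (R1 := 2 * A * S * Q + 2 * P * S * o * (o + 1) * O
             + 2 * m * (Q * Q * / 2 + O * O * (o + 1) * (o + 1) * / 2)).
  set (R2 := 2 * O * P * J * / S + 2 * Q * 2 * A * o ^ 2 * J * / S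
             - 2 * P * A * y * A * o * J * / S
             + 2 * (S - 1) * (2 * P * P * J * i * / r * / S + 2 * A * A * o ^ 2 * J * i * / r * / S)
             + 2 * m * (A * A * o ^ 2 * J * / S * / S + P * P * J * / S * / S)).
  assert (H1 : Rabs R1 <= 24) by (unfold R1; eapply Rle_trans; [abs_bound|lra]).
  assert (H2 : Rabs R2 <= 24) by (unfold R2; eapply Rle_trans; [abs_bound|lra]).
  assert (E : 1 - o ^ 2 = - (y * O * (o + 1))) by (rewrite <- EO; ring).
  rewrite E, EO.
  match goal with |- ?L <= _ => replace L with (t * y ^ 2 * (R1 + c * R2)) end.
  - apply Rabs_le_between in H1, H2.
    assert (R1 + c * R2 <= 24 * (1 + c)) by nra.
    replace (24 * (1 + c) * t * y ^ 2) with (t * y ^ 2 * (24 * (1 + c))) by ring.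
    apply Rmult_le_compat_l; [|assumption].
    apply Rmult_le_pos; [lra|apply pow2_ge_0].
  - unfold R1, R2. subst i a q p. unfold t. field. split; lra.
Qed.

Section Energy.

Variables (ell : R) (s : profile).
Hypothesis hell : ell <> 0.
Hypothesis Hsol : static_EYM_solution ell s.
Hypothesis Hpos : positive_profile s.

Local Notation k := (/ ell ^ 2).
Local Notation mu := (mu0 s).
Local Notation S := (S0 s).
Local Notation al := (alpha0 s).
Local Notation om := (omega0 s).

(* In terms of the fluxes r^2 alpha0' / S0 and mu0 S0 omega0' the field
   equations are first order with right-hand sides O(r^-2). *)
Definition electric_flux (r : R) : R := r ^ 2 * Derive al r / S r.
Definition magnetic_flux (r : R) : R := mu r * S r * Derive om r.

Definition energy (r : R) : R :=
  al r ^ 2 + (om r - 1) ^ 2 + electric_flux r ^ 2 + magnetic_flux r ^ 2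
  + (S r - 1) ^ 2 + m0 ell s r ^ 2.

Lemma profile_derives (r : R) : 0 < r ->
  is_derive mu r (Derive mu r) /\ is_derive S r (Derive S r) /\
  is_derive al r (Derive al r) /\ is_derive om r (Derive om r) /\
  is_derive (Derive al) r (Derive_n al 2 r) /\ is_derive (Derive om) r (Derive_n om 2 r).
Proof.
  intros hr. destruct Hsol as [Hm [HS [Ha [Ho _]]]].
  destruct (Ck_halfline_1 _ Hm) as [_ [Dm _]]. destruct (Ck_halfline_1 _ HS) as [_ [DS _]].
  destruct (Ck_halfline_2 _ Ha) as [_ [Da _]]. destruct (Ck_halfline_2 _ Ho) as [_ [Do _]].
  destruct (Dm r hr), (DS r hr), (Da r hr), (Do r hr).
  repeat match goal with |- _ /\ _ => split end; assumption.
Qed.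

Lemma flux_derives (r : R) : 0 < r ->
  is_derive electric_flux r (2 * al r * om r ^ 2 * / mu r / S r) /\
  is_derive magnetic_flux r
    (- (S r * om r * (1 - om r ^ 2) / r ^ 2) - al r ^ 2 * om r * / mu r / S r).
Proof.
  intros hr. destruct (profile_derives r hr) as [Dm [DS [Da [Do [Da2 Do2]]]]].
  destruct Hsol as [_ [_ [_ [_ Heq]]]].
  destruct (Heq r hr) as [nm [nS [_ [_ [Ea Eo]]]]].
  unfold alpha_equation in Ea. unfold omega_equation in Eo. split.
  - assert (Ea2 : Derive_n al 2 r = (2 * al r * om r ^ 2 / r ^ 2
      - (2 * mu r / r - mu r * Derive S r / S r) * Derive al r) / mu r).
    { apply Rmult_eq_reg_l with (mu r); [|exact nm].
      replace (mu r * ((2 * al r * om r ^ 2 / r ^ 2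
        - (2 * mu r / r - mu r * Derive S r / S r) * Derive al r) / mu r)) with
        (2 * al r * om r ^ 2 / r ^ 2
        - (2 * mu r / r - mu r * Derive S r / S r) * Derive al r) by (field; repeat split; lra).
      lra. }
    eapply is_derive_eq.
    + apply (is_derive_Rdiv (fun t => t ^ 2 * Derive al t) S r _ _
        (is_derive_Rmult _ _ _ _ _ (is_derive_sq _ _ _ (is_derive_id r)) Da2) DS nS).
    + change (((2 * r * 1 * Derive al r + r ^ 2 * Derive_n al 2 r) * S r
        - r ^ 2 * Derive al r * Derive S r) / S r ^ 2 = 2 * al r * om r ^ 2 * / mu r / S r).
      rewrite Ea2. field. repeat split; lra.
  - assert (Eo2 : Derive_n om 2 r = (- ((Derive mu r + mu r * Derive S r / S r) * Derive om r
      + om r * (1 - om r ^ 2) / r ^ 2 + al r ^ 2 * om r / (mu r * S r ^ 2))) / mu r).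
    { apply Rmult_eq_reg_l with (mu r); [|exact nm].
      match goal with |- _ = mu r * (?x / mu r) =>
        replace (mu r * (x / mu r)) with x by (field; repeat split; lra) end.
      lra. }
    eapply is_derive_eq.
    + apply (is_derive_Rmult (fun t => mu t * S t) (Derive om) r _ _
        (is_derive_Rmult _ _ _ _ _ Dm DS) Do2).
    + rewrite Eo2. field. repeat split; lra.
Qed.

Lemma mass_derive (r : R) : 0 < r ->
  is_derive (m0 ell s) r (electric_flux r ^ 2 / (2 * r ^ 2)
    + al r ^ 2 * om r ^ 2 * / mu r / S r ^ 2 + magnetic_flux r ^ 2 * / mu r / S r ^ 2
    + (1 - om r ^ 2) ^ 2 / (2 * r ^ 2)) /\
  r * Derive mu r = 2 * k * r ^ 2 + 2 * m0 ell s r / r - 2 * Derive (m0 ell s) r.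
Proof.
  intros hr. destruct (profile_derives r hr) as [Dm _].
  destruct Hsol as [_ [_ [_ [_ Heq]]]].
  destruct (Heq r hr) as [nm [nS [Em _]]]. unfold mass_equation in Em.
  assert (D : is_derive (m0 ell s) r
    (1 / 2 * (1 - mu r + r ^ 2 / ell ^ 2) + r / 2 * (- Derive mu r + 2 * r / ell ^ 2))).
  { unfold m0. auto_derive.
    - repeat split; try exact I; try (eexists; exact Dm).
    - rewrite (Derive_val _ _ _ Dm). field. exact hell. }
  assert (E : Derive (m0 ell s) r =
    1 / 2 * (1 - mu r + r ^ 2 / ell ^ 2) + r / 2 * (- Derive mu r + 2 * r / ell ^ 2))
    by exact (is_derive_unique _ _ _ D).
  split.
  - apply is_derive_eq with (Derive (m0 ell s) r); [apply Derive_correct; eexists; exact D|].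
    rewrite Em. unfold electric_flux, magnetic_flux. field. repeat split; lra.
  - rewrite E. unfold m0. field. split; lra.
Qed.

Lemma lapse_derive (r : R) : 0 < r ->
  Derive S r = 2 * magnetic_flux r ^ 2 * (/ mu r) ^ 2 / (r * S r)
    + 2 * al r ^ 2 * om r ^ 2 * (/ mu r) ^ 2 / (r * S r).
Proof.
  intros hr. destruct Hsol as [_ [_ [_ [_ Heq]]]].
  destruct (Heq r hr) as [nm [nS [_ [E _]]]]. unfold S_equation in E.
  apply Rmult_eq_reg_r with (/ S r); [|now apply Rinv_neq_0_compat].
  fold (Derive S r / S r). rewrite E. unfold magnetic_flux. field. repeat split; lra.
Qed.

Lemma derives_from_fluxes (r : R) : 0 < r ->
  Derive al r = S r * electric_flux r / r ^ 2 /\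
  Derive om r = magnetic_flux r * / mu r / S r.
Proof.
  intros hr. destruct (Hpos r ltac:(lra)) as [h1 [_ h3]].
  unfold electric_flux, magnetic_flux. split; field; lra.
Qed.

Lemma energy_derive (r : R) : 0 < r ->
  let q := electric_flux r in let p := magnetic_flux r in let i := / mu r in
  is_derive energy r
   (2 * al r * (S r * q / r ^ 2) + 2 * (om r - 1) * (p * i / S r)
    + 2 * q * (2 * al r * om r ^ 2 * i / S r)
    + 2 * p * (- (S r * om r * (1 - om r ^ 2) / r ^ 2) - al r ^ 2 * om r * i / S r)
    + 2 * (S r - 1) * (2 * p ^ 2 * i ^ 2 / (r * S r)
                       + 2 * al r ^ 2 * om r ^ 2 * i ^ 2 / (r * S r))
    + 2 * m0 ell s r * (q ^ 2 / (2 * r ^ 2) + al r ^ 2 * om r ^ 2 * i / S r ^ 2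
                        + p ^ 2 * i / S r ^ 2 + (1 - om r ^ 2) ^ 2 / (2 * r ^ 2))).
Proof.
  intros hr q p i.
  destruct (profile_derives r hr) as [_ [DS [Da [Do _]]]].
  destruct (flux_derives r hr) as [Dq Dp]. destruct (mass_derive r hr) as [Dm _].
  destruct (derives_from_fluxes r hr) as [Ea Eo].
  rewrite Ea in Da. rewrite Eo in Do. rewrite (lapse_derive r hr) in DS.
  assert (M1 : forall (f : R -> R) (l : R), is_derive f r l ->
    is_derive (fun t => (f t - 1) ^ 2) r (2 * (f r - 1) * l)).
  { intros f l H. apply (is_derive_sq (fun t => f t - 1) r l).
    apply is_derive_eq with (l + 0); [|ring].
    exact (is_derive_Rplus f (fun _ => - 1) r l 0 H (is_derive_const (- 1) r)). }
  unfold energy. repeat apply is_derive_Rplus.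
  - exact (is_derive_sq al r _ Da).
  - exact (M1 om _ Do).
  - exact (is_derive_sq electric_flux r _ Dq).
  - exact (is_derive_sq magnetic_flux r _ Dp).
  - exact (M1 S _ DS).
  - exact (is_derive_sq (m0 ell s) r _ Dm).
Qed.

Lemma energy_components (r y : R) : 0 <= y -> energy r <= y ^ 2 ->
  Rabs (al r) <= y /\ Rabs (om r - 1) <= y /\ Rabs (electric_flux r) <= y /\
  Rabs (magnetic_flux r) <= y /\ Rabs (S r - 1) <= y /\ Rabs (m0 ell s r) <= y.
Proof.
  intros hy H. unfold energy in H.
  pose proof (pow2_ge_0 (al r)). pose proof (pow2_ge_0 (om r - 1)).
  pose proof (pow2_ge_0 (electric_flux r)). pose proof (pow2_ge_0 (magnetic_flux r)).
  pose proof (pow2_ge_0 (S r - 1)). pose proof (pow2_ge_0 (m0 ell s r)).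
  assert (A : forall x, x ^ 2 <= y ^ 2 -> Rabs x <= y).
  { intros x hx. apply Rabs_le; split; nra. }
  repeat split; apply A; lra.
Qed.

Lemma mu_lower (r : R) : 1 <= r -> Rabs (m0 ell s r) <= 1 / 4 ->
  1 / 2 + k * r ^ 2 <= mu r <= 3 / 2 + k * r ^ 2.
Proof.
  intros hr Hm. apply Rabs_le_between in Hm.
  assert (E : mu r = 1 - 2 * m0 ell s r * / r + k * r ^ 2).
  { unfold m0. field. split; [exact hell|lra]. }
  assert (0 < / r <= 1).
  { split; [apply Rinv_0_lt_compat; lra|]. rewrite <- Rinv_1. apply Rinv_le_contravar; lra. }
  rewrite E. nra.
Qed.

Lemma mu_inv_bounds (r : R) : 1 <= r -> 1 / 2 + k * r ^ 2 <= mu r ->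
  0 <= / mu r <= 2 /\ / mu r <= / k * / r ^ 2.
Proof.
  intros hr H.
  assert (hk : 0 < k) by (apply Rinv_0_lt_compat; pose proof (pow2_gt_0 ell hell); lra).
  assert (hr2 : 0 < r ^ 2) by (apply pow_lt; lra).
  assert (hkr : 0 < k * r ^ 2) by now apply Rmult_lt_0_compat.
  repeat split.
  - left. apply Rinv_0_lt_compat. lra.
  - replace 2 with (/ (1 / 2)) by field. apply Rinv_le_contravar; lra.
  - rewrite <- Rinv_mult. apply Rinv_le_contravar; lra.
Qed.

Definition growth : R := 24 * (1 + / k).

Lemma energy_bound (d : R) :
  d <= 1 / 16 -> energy 1 * exp growth < d ->
  forall r, 1 <= r -> energy r < d.
Proof.
  intros hd H1.
  assert (hE : forall r, 0 <= energy r).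
  { intros r. unfold energy.
    repeat apply Rplus_le_le_0_compat; apply pow2_ge_0. }
  assert (hk : 0 < k) by (apply Rinv_0_lt_compat; pose proof (pow2_gt_0 ell hell); lra).
  assert (hki : 0 < / k) by now apply Rinv_0_lt_compat.
  assert (hg : 0 < growth) by (unfold growth; lra).
  assert (he : forall x, 0 <= x -> 1 <= exp x).
  { intros x [h|<-]; [|rewrite exp_0; lra]. rewrite <- exp_0 at 1.
    left. now apply exp_increasing. }
  apply bootstrap.
  - intros x hx. eapply is_derive_continuity_pt. apply energy_derive. lra.
  - pose proof (he growth ltac:(lra)). pose proof (hE 1). nra.
  - intros b hb Hb.
    assert (Hle : - (energy 1 * exp (growth / 1)) <= - (energy b * exp (growth / b))).
    { apply (derive_nonneg_le (fun t => - (energy t * exp (growth / t)))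
        (fun t => - (Derive energy t * exp (growth / t)
                     + energy t * - (growth * / t ^ 2 * exp (growth / t))))); [exact hb| |].
      - intros t Ht. apply is_derive_Ropp.
        apply (is_derive_Rmult energy (fun t => exp (growth / t)) t).
        + apply Derive_correct. eexists. apply energy_derive; lra.
        + auto_derive; [lra|]. unfold Rdiv. field. lra.
      - intros t Ht.
        set (e := exp (growth / t)). assert (0 < e) by apply exp_pos.
        assert (HY : Derive energy t <= growth * / t ^ 2 * energy t).
        { set (y := sqrt (energy t)).
          assert (hy : 0 <= y) by apply sqrt_pos.
          assert (Ey : y ^ 2 = energy t) by (apply pow2_sqrt, hE).
          assert (hy4 : y <= 1 / 4).
          { pose proof (Hb t Ht). nra. }
          destruct (energy_components t y hy ltac:(lra)) as [c1 [c2 [c3 [c4 [c5 c6]]]]].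
          destruct (mu_lower t ltac:(lra) ltac:(lra)) as [hm _].
          destruct (mu_inv_bounds t ltac:(lra) hm) as [i1 i2].
          rewrite <- Ey. unfold growth.
          rewrite (is_derive_unique _ _ _ (energy_derive t ltac:(lra))).
          apply energy_rate; lra. }
        nra. }
    rewrite Rdiv_1_r in Hle.
    assert (1 <= exp (growth / b)).
    { apply he. apply Rdiv_le_0_compat; lra. }
    pose proof (hE b). nra.
Qed.

End Energy.

(** * Uniform smallness near the trivial solution *)

Definition near_trivial (k eps : R) (s : profile) : Prop :=
  forall r, 0 < r <= 1 ->
    Rabs (mu0 s r - (1 + k * r ^ 2)) < eps /\
    Rabs (Derive (mu0 s) r - 2 * k * r) < eps /\
    Rabs (S0 s r - 1) < eps /\
    Rabs (Derive (S0 s) r) < eps /\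
    Rabs (Derive (alpha0 s) r) < eps /\
    Rabs (Derive_n (omega0 s) 2 r) < eps.

Section Smallness.

Variables (ell S1 w2 a1 : R) (s : profile).
Hypothesis hell : ell <> 0.
Hypothesis Hsol : soliton_solution ell s S1 w2 a1.
Hypothesis Hpos : positive_profile s.

Local Notation k := (/ ell ^ 2).
Local Notation mu := (mu0 s).
Local Notation S := (S0 s).
Local Notation al := (alpha0 s).
Local Notation om := (omega0 s).

Lemma inv_ell2_pos : 0 < k.
Proof. apply Rinv_0_lt_compat. pose proof (pow2_gt_0 ell hell). lra. Qed.

Lemma near_trivial_fields (eps r : R) : near_trivial k eps s -> 0 < r <= 1 ->
  Rabs (al r) <= eps * r /\ Rabs (Derive om r) <= eps * r /\
  Rabs (om r - 1) <= eps * r ^ 2.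
Proof.
  intros Hn.
  pose proof (profile_derives ell s (proj1 Hsol)) as D.
  assert (A1 : forall x, 0 < x <= 1 -> Rabs (al x) <= eps * x ^ 1).
  { apply (derive_bound_at_0 al (Derive al)).
    - exact (alpha_lim0 _ _ _ _ _ Hsol).
    - intros x Hx. destruct (D x ltac:(lra)) as [_ [_ [D3 _]]]. exact D3.
    - intros x Hx. rewrite pow_O, Rmult_1_r. left. now apply Hn. }
  assert (A2 : forall x, 0 < x <= 1 -> Rabs (Derive om x) <= eps * x ^ 1).
  { apply (derive_bound_at_0 (Derive om) (Derive_n om 2)).
    - exact (omega_deriv_lim0 _ _ _ _ _ Hsol).
    - intros x Hx. destruct (D x ltac:(lra)) as [_ [_ [_ [_ [_ D6]]]]]. exact D6.
    - intros x Hx. rewrite pow_O, Rmult_1_r. left. now apply Hn. }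
  assert (A3 : forall x, 0 < x <= 1 -> Rabs (om x - 1) <= eps * x ^ 2).
  { apply (derive_bound_at_0 (fun x => om x - 1) (Derive om)).
    - exact (omega_lim0 _ _ _ _ _ Hsol).
    - intros x Hx. destruct (D x ltac:(lra)) as [_ [_ [_ [D4 _]]]].
      apply is_derive_eq with (Derive om x + 0); [|ring].
      apply (is_derive_Rplus om (fun _ => - 1)); [exact D4|].
      apply (is_derive_const (- 1)).
    - exact A2. }
  intros Hr. rewrite <- (pow_1 r) at 2 4. auto.
Qed.

Lemma small_near (eps eta r : R) :
  0 < eps <= / 2 -> 8 * eps <= eta -> near_trivial k eps s -> 0 < r <= 1 ->
  small_profile k eta s r.
Proof.
  intros heps heta Hn Hr. pose proof inv_ell2_pos as hk.
  destruct (near_trivial_fields eps r Hn Hr) as [Hal [Hom' Hom]].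
  destruct (Hn r Hr) as [Hm [Hm' [HS [HS' [Hal' _]]]]].
  set (w := / (1 + r)).
  assert (hw : / 2 <= w) by (apply Rinv_le_contravar; lra).
  assert (hw2 : / 4 <= w ^ 2) by nra.
  assert (hw3 : / 8 <= w ^ 3) by (simpl; nra).
  assert (hr2 : 0 < r ^ 2) by (apply pow_lt; lra).
  assert (hkr : 0 < k * r ^ 2) by now apply Rmult_lt_0_compat.
  apply Rabs_def2 in Hm.
  constructor; fold w.
  - eapply Rle_trans; [exact Hal|].
    apply Rle_trans with (eta * (r * / 2)); [nra|].
    apply Rmult_le_compat_l; [lra|]. apply Rmult_le_compat_l; lra.
  - apply Rle_trans with (eta * / 4); [lra|]. apply Rmult_le_compat_l; lra.
  - eapply Rle_trans; [exact Hom|]. rewrite Rpow_mult_distr.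
    apply Rle_trans with (eta * (r ^ 2 * / 4)); [nra|].
    apply Rmult_le_compat_l; [lra|]. apply Rmult_le_compat_l; lra.
  - eapply Rle_trans; [exact Hom'|].
    apply Rle_trans with (eta * (r * / 8)); [nra|].
    apply Rmult_le_compat_l; [lra|]. apply Rmult_le_compat_l; lra.
  - lra.
  - assert (Rabs (Derive mu r) <= 2 * k * r + eps).
    { replace (Derive mu r) with ((Derive mu r - 2 * k * r) + 2 * k * r) by ring.
      eapply Rle_trans; [apply Rabs_triang|].
      rewrite (Rabs_pos_eq (2 * k * r)) by nra. lra. }
    apply Rle_trans with (r * (2 * k * r + eps)); [apply Rmult_le_compat_l; lra|].
    nra.
  - lra.
  - apply Rabs_def2 in HS. pose proof (Rabs_pos (Derive S r)). nra.
Qed.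

Lemma small_far (y eta : R) :
  0 < y <= 1 / 8 -> 12 * (1 + / k) * y <= eta ->
  energy ell s 1 * exp (growth ell) < y ^ 2 ->
  forall r, 1 <= r -> small_profile k eta s r.
Proof.
  intros hy heta HE r hr. pose proof inv_ell2_pos as hk.
  assert (hki : 0 < / k) by now apply Rinv_0_lt_compat.
  pose proof (energy_bound ell s hell (proj1 Hsol) Hpos (y ^ 2) ltac:(nra) HE r hr) as Hen.
  destruct (energy_components ell s r y ltac:(lra) ltac:(lra)) as [c1 [c2 [c3 [c4 [c5 c6]]]]].
  destruct (mu_lower ell s hell r hr ltac:(lra)) as [hm1 hm2].
  destruct (mu_inv_bounds ell s hell r hr hm1) as [i1 i2].
  destruct (derives_from_fluxes s Hpos r ltac:(lra)) as [Ea Eo].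
  destruct (mass_derive ell s hell (proj1 Hsol) r ltac:(lra)) as [Dm Em'].
  pose proof (is_derive_unique _ _ _ Dm) as Em. clear Dm.
  pose proof (lapse_derive ell s (proj1 Hsol) r ltac:(lra)) as ES.
  assert (hr2 : 1 <= r ^ 2) by nra.
  assert (hkr : 0 < k * r ^ 2) by (apply Rmult_lt_0_compat; lra).
  set (w := / (1 + r)).
  assert (hw : / (2 * r) <= w) by (apply Rinv_le_contravar; lra).
  assert (hir : 0 < / (2 * r)) by (apply Rinv_0_lt_compat; lra).
  assert (hrw : / 2 <= r * w).
  { replace (/ 2) with (r * / (2 * r)) by (field; lra). apply Rmult_le_compat_l; lra. }
  set (t := / r ^ 2) in *.
  assert (ht : 0 < t <= 1).
  { split; [apply Rinv_0_lt_compat; lra|]. rewrite <- Rinv_1. apply Rinv_le_contravar; lra. }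
  assert (hw2 : t * / 4 <= w ^ 2).
  { replace (t * / 4) with ((/ (2 * r)) ^ 2) by (unfold t; field; lra).
    apply pow_incr; lra. }
  assert (hw3 : t * / 8 <= r * w ^ 3).
  { replace (r * w ^ 3) with ((r * w) * w ^ 2) by ring.
    replace (t * / 8) with (/ 2 * (t * / 4)) by field.
    apply Rmult_le_compat; lra. }
  assert (Hk : 12 * y + 12 * (/ k * y) <= eta) by lra.
  assert (hky : 0 < / k * y) by (apply Rmult_lt_0_compat; lra).
  assert (hS : 7 / 8 <= S r <= 9 / 8) by (apply Rabs_le_between in c5; lra).
  assert (ho : 7 / 8 <= om r <= 9 / 8) by (apply Rabs_le_between in c2; lra).
  assert (HSs : Rabs (S r) <= 9 / 8) by (apply Rabs_le; lra).
  assert (HSi : Rabs (/ S r) <= 8 / 7).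
  { rewrite Rabs_pos_eq by (left; apply Rinv_0_lt_compat; lra).
    replace (8 / 7) with (/ (7 / 8)) by field. apply Rinv_le_contravar; lra. }
  assert (Ht : Rabs t <= t) by (rewrite Rabs_pos_eq; lra).
  assert (Hi : Rabs (/ mu r) <= / k * t) by (rewrite Rabs_pos_eq; lra).
  assert (Hi2 : Rabs (/ mu r) <= 2) by (rewrite Rabs_pos_eq; lra).
  set (q := electric_flux s r) in *. set (p := magnetic_flux s r) in *.
  constructor; fold w.
  - apply Rle_trans with (eta * / 2); [lra|]. apply Rmult_le_compat_l; lra.
  - rewrite Ea. replace (S r * q / r ^ 2) with (S r * q * t) by reflexivity.
    apply Rle_trans with (9 / 8 * y * t); [abs_bound|].
    apply Rle_trans with (eta * (t * / 4)); [|apply Rmult_le_compat_l; lra].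
    replace (eta * (t * / 4)) with (eta * / 4 * t) by ring.
    apply Rmult_le_compat_r; lra.
  - apply Rle_trans with (eta * (/ 2) ^ 2); [lra|].
    apply Rmult_le_compat_l; [lra|]. apply pow_incr; lra.
  - rewrite Eo. replace (p * / mu r / S r) with (p * / mu r * / S r) by reflexivity.
    apply Rle_trans with (y * (/ k * t) * (8 / 7)).
    { apply abs_mult_le; [now apply abs_mult_le|assumption]. }
    apply Rle_trans with (eta * (t * / 8)); [|apply Rmult_le_compat_l; lra].
    replace (y * (/ k * t) * (8 / 7)) with (t * (/ k * y * (8 / 7))) by ring.
    replace (eta * (t * / 8)) with (t * (eta * / 8)) by ring.
    apply Rmult_le_compat_l; lra.
  - lra.
  - assert (Hy : Rabs y <= 1 / 8) by (apply Rabs_le; lra).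
    assert (b1 : Rabs (al r) <= 1 / 8) by lra. assert (b2 : Rabs (om r - 1) <= 1 / 8) by lra.
    assert (b3 : Rabs q <= 1 / 8) by lra. assert (b4 : Rabs p <= 1 / 8) by lra.
    assert (b6 : Rabs (m0 ell s r) <= 1 / 8) by lra.
    assert (Ho1 : Rabs (om r + 1) <= 17 / 8) by (apply Rabs_le; lra).
    assert (Ho : Rabs (om r) <= 9 / 8) by (apply Rabs_le; lra).
    assert (Ht1 : Rabs t <= 1) by lra.
    assert (Hri : Rabs (/ r) <= 1).
    { rewrite Rabs_pos_eq by (left; apply Rinv_0_lt_compat; lra).
      rewrite <- Rinv_1. apply Rinv_le_contravar; lra. }
    assert (HM : Rabs (Derive (m0 ell s) r) <= 1 / 4).
    { rewrite Em.
      replace (_ + _) with (q * q * / 2 * t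
        + al r * al r * om r * om r * / mu r * / S r * / S r
        + p * p * / mu r * / S r * / S r
        + (om r - 1) * (om r + 1) * (om r - 1) * (om r + 1) * / 2 * t)
        by (unfold t; field; split; lra).
      clear Hi c1 c2 c3 c4 c5 c6 Ht. eapply Rle_trans; [abs_bound|lra]. }
    assert (Hr : Rabs (r * Derive mu r) <= 2 * (k * r ^ 2) + 3 / 4).
    { rewrite Em'. replace (2 * k * r ^ 2 + 2 * m0 ell s r / r - 2 * Derive (m0 ell s) r)
        with (2 * (k * r ^ 2) + (2 * m0 ell s r * / r - 2 * Derive (m0 ell s) r)) by (field; lra).
      apply abs_plus_le; [rewrite Rabs_pos_eq; lra|].
      clear Hi c1 c2 c3 c4 c5 c6 Ht. eapply Rle_trans; [abs_bound|lra]. }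
    rewrite Rabs_mult, (Rabs_pos_eq r) in Hr by lra. lra.
  - lra.
  - assert (b1 : Rabs (al r) <= 1 / 8) by lra. assert (b4 : Rabs p <= 1 / 8) by lra.
    assert (Ho : Rabs (om r) <= 9 / 8) by (apply Rabs_le; lra).
    assert (Hr : Rabs (r * Derive S r) <= 7 / 8).
    { rewrite ES.
      replace (r * _) with (2 * p * p * / mu r * / mu r * / S r
        + 2 * al r * al r * om r * om r * / mu r * / mu r * / S r)
        by (field; repeat split; lra).
      clear Hi c1 c2 c3 c4 c5 c6 Ht. eapply Rle_trans; [abs_bound|lra]. }
    rewrite Rabs_mult, (Rabs_pos_eq r) in Hr by lra. lra.
Qed.

Lemma energy_at_1 (eps : R) : 0 < eps <= / 2 -> near_trivial k eps s ->
  energy ell s 1 <= eps ^ 2 * (6 + 2 * k) ^ 2.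
Proof.
  intros heps Hn. pose proof inv_ell2_pos as hk.
  destruct (near_trivial_fields eps 1 Hn ltac:(lra)) as [Hal [Hom' Hom]].
  destruct (Hn 1 ltac:(lra)) as [Hm [_ [HS [_ [Hal' _]]]]].
  rewrite pow1, Rmult_1_r in *.
  assert (hS : 1 / 2 <= S 1 <= 3 / 2) by (apply Rabs_def2 in HS; lra).
  assert (hm : 0 <= mu 1 <= 3 / 2 + k) by (apply Rabs_def2 in Hm; lra).
  assert (Hq : Rabs (electric_flux s 1) <= eps * 2).
  { unfold electric_flux. rewrite pow1, Rmult_1_l. unfold Rdiv.
    apply abs_mult_le; [lra|]. rewrite Rabs_pos_eq by (left; apply Rinv_0_lt_compat; lra).
    replace 2 with (/ (1 / 2)) by field. apply Rinv_le_contravar; lra. }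
  assert (Hp : Rabs (magnetic_flux s 1) <= (3 / 2 + k) * (3 / 2) * eps).
  { unfold magnetic_flux. apply abs_mult_le; [apply abs_mult_le|assumption];
      apply Rabs_le; lra. }
  assert (HM : Rabs (m0 ell s 1) <= eps).
  { unfold m0. replace (1 / 2 * (1 - mu 1 + 1 ^ 2 / ell ^ 2))
      with (1 / 2 * - (mu 1 - (1 + k))) by (field; exact hell).
    rewrite Rabs_mult, Rabs_Ropp, (Rabs_pos_eq (1 / 2)) by lra. lra. }
  assert (SQ : forall x b, Rabs x <= b -> x ^ 2 <= b ^ 2).
  { intros x b Hx. rewrite <- pow2_abs. apply pow_incr. split; [apply Rabs_pos|exact Hx]. }
  unfold energy.
  pose proof (SQ _ _ Hal). pose proof (SQ _ _ Hom). pose proof (SQ _ _ Hq).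
  pose proof (SQ _ _ Hp). pose proof (SQ _ _ (Rlt_le _ _ HS)). pose proof (SQ _ _ HM).
  pose proof (pow2_ge_0 eps).
  assert (8 + ((3 / 2 + k) * (3 / 2)) ^ 2 <= (6 + 2 * k) ^ 2) by nra.
  nra.
Qed.

Theorem near_trivial_small (eta : R) : 0 < eta <= 1 / 4 ->
  near_trivial k (eta / (12 * (1 + / k)) / (exp (growth ell) * (6 + 2 * k))) s ->
  forall r, 0 < r -> small_profile k eta s r.
Proof.
  intros heta. pose proof inv_ell2_pos as hk.
  assert (hki : 0 < / k) by now apply Rinv_0_lt_compat.
  set (y := eta / (12 * (1 + / k))).
  assert (Ey : 12 * (1 + / k) * y = eta) by (unfold y; field; split; [exact hell|pose proof (pow2_ge_0 ell); lra]).
  set (e := exp (growth ell)).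
  assert (he : 1 < e).
  { unfold e. rewrite <- exp_0. apply exp_increasing. unfold growth. lra. }
  set (D := e * (6 + 2 * k)).
  assert (hD : 6 < D) by (unfold D; nra).
  assert (hy : 0 < y) by (apply Rdiv_lt_0_compat; lra).
  set (eps := y / D).
  assert (Eeps : eps * D = y) by (unfold eps; field; lra).
  assert (hep : 0 < eps) by (apply Rdiv_lt_0_compat; lra).
  assert (h12 : 12 * y <= eta) by nra.
  assert (h6 : 6 * eps <= y) by nra.
  intros Hn r hr. destruct (Rle_dec r 1) as [h|h].
  - apply small_near with eps; [lra|lra|exact Hn|lra].
  - apply small_far with y; [lra|lra| |lra].
    pose proof (energy_at_1 eps ltac:(lra) Hn) as HE. fold e.
    replace (y ^ 2) with (eps ^ 2 * (6 + 2 * k) ^ 2 * (e * e))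
      by (rewrite <- Eeps; unfold D; ring).
    assert (0 < eps ^ 2 * (6 + 2 * k) ^ 2).
    { apply Rmult_lt_0_compat; apply pow_lt; lra. }
    apply Rle_lt_trans with (eps ^ 2 * (6 + 2 * k) ^ 2 * e).
    + apply Rmult_le_compat_r; lra.
    + apply Rmult_lt_compat_l; nra.
Qed.

End Smallness.

(** * The trivial solution and the neighbourhood *)

Definition ads_profile (ell : R) : profile :=
  Profile (fun r => 1 + r ^ 2 / ell ^ 2) (fun _ => 1) (fun _ => 0) (fun _ => 1).

Lemma Ck_halfline_intro (f f' f'' : R -> R) (k : nat) :
  (forall r, is_derive f r (f' r)) -> (forall r, is_derive f' r (f'' r)) ->
  (forall r, continuous f'' r) -> (k <= 2)%nat -> Ck_halfline k f.
Proof.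
  intros H1 H2 Hc hk.
  assert (E1 : Derive f = f')
    by (apply functional_extensionality; intros r; apply is_derive_unique, H1).
  assert (E2 : Derive f' = f'')
    by (apply functional_extensionality; intros r; apply is_derive_unique, H2).
  assert (L : forall (g : R -> R) r, continuous g r -> filterlim g (at_right r) (locally (g r))).
  { intros g r Hg P HP. destruct (Hg P HP) as [d Hd].
    exists d. intros x hx _. now apply Hd. }
  assert (C0 : forall r, continuous f r) by (intros r; exact (is_derive_cont _ _ _ (H1 r))).
  assert (C1 : forall r, continuous f' r) by (intros r; exact (is_derive_cont _ _ _ (H2 r))).
  split; [now apply L|]. intros j hj.
  destruct j as [|[|[|j]]]; [| | |lia].
  - split; [|exists (f 0); now apply L]. intros r _. split; [exact I|apply C0].
  - change (Derive_n f 1) with (Derive f). rewrite E1.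
    split; [|exists (f' 0); now apply L]. intros r _.
    split; [exists (f' r); apply H1|apply C1].
  - change (Derive_n f 2) with (Derive (Derive f)). rewrite E1, E2.
    split; [|exists (f'' 0); now apply L]. intros r _.
    split; [|apply Hc]. change (ex_derive (Derive f) r). rewrite E1. now exists (f'' r).
Qed.

Lemma Ck_halfline_const (c : R) (k : nat) : (k <= 2)%nat -> Ck_halfline k (fun _ => c).
Proof.
  apply Ck_halfline_intro with (fun _ => 0) (fun _ => 0); intros r.
  - apply (is_derive_const c).
  - apply (is_derive_const 0).
  - apply continuous_const.
Qed.

Lemma ads_mu_derive (ell r : R) : is_derive (mu0 (ads_profile ell)) r (2 * / ell ^ 2 * r).
Proof. simpl. auto_derive; [exact I|]. unfold Rdiv; ring. Qed.

Lemma bigO_zero_0 (n : nat) (f : R -> R) : (forall r, 0 < r -> f r = 0) -> bigO_zero n f.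
Proof.
  intros H. exists 0, 1. split; [lra|]. intros r Hr.
  rewrite H, Rabs_R0 by lra. lra.
Qed.

Lemma ads_soliton (ell : R) : ell <> 0 -> soliton_solution ell (ads_profile ell) 1 0 0.
Proof.
  intros hell.
  assert (Em : m0 ell (ads_profile ell) = fun _ => 0).
  { apply functional_extensionality. intros r. unfold m0, ads_profile; simpl. field. exact hell. }
  assert (D0 : forall c r : R, Derive (fun _ => c) r = 0) by (intros; apply Derive_const).
  split; [split; [|split; [|split; [|split]]]|split; [|split; [|split]]].
  - apply Ck_halfline_intro with (fun r => 2 * / ell ^ 2 * r) (fun _ => 2 * / ell ^ 2);
      [apply ads_mu_derive| | |lia]; intros r.
    + apply is_derive_eq with (2 * / ell ^ 2 * 1); [|apply Rmult_1_r].
      apply (is_derive_scal (fun x => x) r (2 * / ell ^ 2) 1), (is_derive_id r).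
    + apply continuous_const.
  - apply Ck_halfline_const; lia.
  - apply Ck_halfline_const; lia.
  - apply Ck_halfline_const; lia.
  - intros r hr.
    assert (hmu : 0 < mu0 (ads_profile ell) r).
    { simpl. assert (0 < r * (r * 1) / (ell * (ell * 1))); [|lra].
      apply Rdiv_lt_0_compat; [nra|]. pose proof (pow2_gt_0 ell hell). simpl in *. lra. }
    unfold mass_equation, S_equation, alpha_equation, omega_equation. rewrite Em.
    unfold ads_profile in *; cbn [mu0 S0 alpha0 omega0] in *.
    change (Derive_n (fun _ => 0) 2 r) with (Derive (Derive (fun _ : R => 0)) r).
    change (Derive_n (fun _ => 1) 2 r) with (Derive (Derive (fun _ : R => 1)) r).
    assert (E0 : forall c : R, Derive (fun _ : R => c) = fun _ => 0)
      by (intros c; apply functional_extensionality; intros; apply D0).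
    rewrite !E0. cbv beta.
    repeat split; try lra; field; repeat split; lra.
  - apply bigO_zero_0. intros r hr. rewrite Em. field.
  - apply bigO_zero_0. intros r hr. simpl. field.
  - apply bigO_zero_0. intros r hr. simpl. field. exact hell.
  - apply bigO_zero_0. intros r hr. simpl. ring.
Qed.

Lemma same_on_halfline_Derive_n (f g : R -> R) (n : nat) (r : R) :
  (forall x, 0 <= x -> f x = g x) -> 0 < r -> Derive_n f n r = Derive_n g n r.
Proof.
  intros H hr. apply Derive_n_ext_loc. exists (mkposreal r hr). intros y Hy.
  apply H. change (Rabs (y - r) < r) in Hy. apply Rabs_def2 in Hy. lra.
Qed.

Lemma Ck_close_ads (ell eps : R) (s st : profile) :
  ell <> 0 -> same_on_halfline (ads_profile ell) st ->
  Ck_close 1 1 eps (mu0 s) (mu0 st) -> Ck_close 1 1 eps (S0 s) (S0 st) ->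
  Ck_close 2 1 eps (alpha0 s) (alpha0 st) -> Ck_close 2 1 eps (omega0 s) (omega0 st) ->
  near_trivial (/ ell ^ 2) eps s.
Proof.
  intros hell Hs Hm HS Ha Ho r Hr.
  assert (E : forall (pr : profile -> R -> R) n,
    (forall x, 0 <= x -> pr (ads_profile ell) x = pr st x) ->
    Derive_n (pr st) n r = Derive_n (pr (ads_profile ell)) n r).
  { intros pr n H. symmetry. apply same_on_halfline_Derive_n; [exact H|lra]. }
  pose proof (Hm 0%nat r ltac:(lia) Hr) as B1. pose proof (Hm 1%nat r ltac:(lia) Hr) as B2.
  pose proof (HS 0%nat r ltac:(lia) Hr) as B3. pose proof (HS 1%nat r ltac:(lia) Hr) as B4.
  pose proof (Ha 1%nat r ltac:(lia) Hr) as B5. pose proof (Ho 2%nat r ltac:(lia) Hr) as B6.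
  rewrite (E mu0) in B1, B2 by (intros x hx; apply Hs; exact hx).
  rewrite (E S0) in B3, B4 by (intros x hx; apply Hs; exact hx).
  rewrite (E alpha0) in B5 by (intros x hx; apply Hs; exact hx).
  rewrite (E omega0) in B6 by (intros x hx; apply Hs; exact hx).
  assert (D0 : forall c : R, Derive (fun _ : R => c) = fun _ => 0)
    by (intros c; apply functional_extensionality; intros; apply Derive_const).
  change (Rabs (mu0 s r - (1 + r ^ 2 / ell ^ 2)) < eps) in B1.
  change (Rabs (Derive (mu0 s) r - Derive (mu0 (ads_profile ell)) r) < eps) in B2.
  change (Rabs (S0 s r - 1) < eps) in B3.
  change (Rabs (Derive (S0 s) r - Derive (fun _ => 1) r) < eps) in B4.
  change (Rabs (Derive (alpha0 s) r - Derive (fun _ => 0) r) < eps) in B5.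
  change (Rabs (Derive_n (omega0 s) 2 r - Derive (Derive (fun _ => 1)) r) < eps) in B6.
  rewrite (is_derive_unique _ _ _ (ads_mu_derive ell r)) in B2.
  rewrite D0 in B4, B5. rewrite !D0 in B6. cbv beta in B4, B5, B6.
  rewrite Rminus_0_r in B4, B5, B6.
  repeat split; try assumption.
  replace (1 + / ell ^ 2 * r ^ 2) with (1 + r ^ 2 / ell ^ 2) by (unfold Rdiv; ring).
  exact B1.
Qed.

Theorem proposition3 (Lambda ell : R) (hLambda : Lambda < 0)
    (hell : ell ^ 2 = - 3 / Lambda) (hexist : soliton_existence ell) :
  exists U : R * R * R -> Prop,
    locally (1, 0, 0) U /\
    forall S1 w2 a1 : R, U (S1, w2, a1) ->
      exists s : profile,
        the_soliton ell S1 w2 a1 s /\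
        (forall r : R, 0 < r -> 0 < K1 s r /\ 0 < K2 s r) /\
        linearly_stable s.
Proof.
  assert (hell0 : ell <> 0).
  { intros e. rewrite e in hell. apply Rlt_irrefl with 0.
    replace 0 with (0 ^ 2) at 2 by ring. rewrite hell.
    replace (- 3 / Lambda) with (3 / - Lambda) by (field; lra).
    apply Rdiv_lt_0_compat; lra. }
  pose proof (inv_ell2_pos ell hell0) as hk. set (k := / ell ^ 2) in *.
  pose proof (stretch_ge k hk) as hN.
  set (eta := / (200 * stretch k ^ 2)).
  assert (heta : 0 < eta <= 1 / 4).
  { unfold eta. split; [apply Rinv_0_lt_compat; nra|].
    replace (1 / 4) with (/ 4) by field. apply Rinv_le_contravar; nra. }
  set (eps := eta / (12 * (1 + / k)) / (exp (growth ell) * (6 + 2 * k))).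
  assert (heps : 0 < eps).
  { assert (0 < / k) by now apply Rinv_0_lt_compat. pose proof (exp_pos (growth ell)).
    unfold eps. apply Rdiv_lt_0_compat; [apply Rdiv_lt_0_compat; lra|].
    apply Rmult_lt_0_compat; lra. }
  destruct hexist as [V [sol [HV [Hsol Hdep]]]].
  assert (V0 : V (1, 0, 0)) by (apply (locally_singleton _ _ HV)).
  destruct (Hdep 1 0 0 V0 1 eps Rlt_0_1 heps) as [d [hd Hd]].
  pose proof (proj1 (proj2 (Hsol 1 0 0 V0)) _ (ads_soliton ell hell0)) as Hads.
  exists (fun x => V x /\ ball (1, 0, 0) d x). split.
  { apply filter_and; [exact HV|]. exists (mkposreal d hd). now intros y Hy. }
  intros S1 w2 a1 [HVx [[H1 H2] H3]].
  change (Rabs (S1 - 1) < d) in H1. change (Rabs (w2 - 0) < d) in H2.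
  change (Rabs (a1 - 0) < d) in H3.
  destruct (Hd S1 w2 a1 HVx H1 H2 H3) as [C1 [C2 [C3 C4]]].
  pose proof (Ck_close_ads ell eps _ _ hell0 Hads C1 C2 C3 C4) as Hn.
  destruct (Hsol S1 w2 a1 HVx) as [Hs [Huniq [Hpos Has]]].
  pose proof (near_trivial_small ell S1 w2 a1 _ hell0 Hs Hpos eta heta Hn) as Hsmall.
  assert (heta' : 0 < eta <= / (200 * stretch k ^ 2)) by (unfold eta in *; lra).
  exists (sol S1 w2 a1). split; [now split|]. split.
  - exact (K_positive ell k eta S1 w2 a1 _ hk heta' Hs Hpos Hsmall).
  - exact (soliton_linearly_stable ell k eta S1 w2 a1 _ hk heta' Hs Hpos Hsmall).
Qed.
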